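(* If $\mathcal{R}=(R,\oplus,\leq,0)$ is a Urysohn monoid, then $\mathrm{Th}(\mathcal{U}_{\mathcal{R}})$ has weak elimination of imaginaries if and only if $\mathcal{R}$ has no nonzero and non-maximal idempotents, i.e. there is no $r\in R$ with $r\oplus r=r$, $r\neq 0$, and $r$ not the maximal element of $R$.
   Context: A distance monoid is a structure $\mathcal{R}=(R,\oplus,\leq,0)$ such that $(R,\oplus,0)$ is a commutative monoid and $\leq$ is a total, translation-invariant order on $R$ with least element $0$. An $\mathcal{R}$-metric space is a set $A$ with a symmetric function $d:A\times A\to R$ such that $d(x,y)=0$ iff $x=y$, and $d(x,z)\leq d(x,y)\oplus d(y,z)$ for all $x,y,z\in A$. For countable $\mathcal{R}$, the $\mathcal{R}$-Urysohn space $\mathcal{U}_{\mathcal{R}}$ is the unique (up to isometry) countable $\mathcal{R}$-metric space that is ultrahomogeneous and contains an isometric copy of every finite $\mathcal{R}$-metric space. It is viewed as a structure in the relational language $\mathcal{L}_R=\{d(x,y)\leq r:r\in R\}$ of binary relations, and $\mathrm{Th}(\mathcal{U}_{\mathcal{R}})$ is its complete $\mathcal{L}_R$-theory. A Urysohn monoid is a countable distance monoid $\mathcal{R}$ such that $\mathrm{Th}(\mathcal{U}_{\mathcal{R}})$ has quantifier elimination in $\mathcal{L}_R$. Let $T$ be a complete theory with monster model $\mathbb{M}$. Given an imaginary $e\in\mathbb{M}^{\mathrm{eq}}$, a weak canonical parameter for $e$ is a finite tuple $\bar c$ of elements of $\mathbb{M}$ such that $\bar c\in\mathrm{acl}^{\mathrm{eq}}(e)$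 and $e\in\mathrm{dcl}^{\mathrm{eq}}(\bar c)$. $T$ has weak elimination of imaginaries if every imaginary has a weak canonical parameter. *)

(* Defs.v *)
From HB Require Import structures.
From mathcomp Require Import all_boot all_order.
From mathcomp Require Import boolp classical_sets functions cardinality.

Set Implicit Arguments.
Unset Strict Implicit.
Unset Printing Implicit Defensive.

Import Order.TTheory.

Local Open Scope classical_set_scope.
Local Open Scope card_scope.

(* Translation invariance is the non-strict implication: cancellation is not
   required, so idempotents and truncated addition are allowed. *)
Record distanceMonoid (d : Order.disp_t) := DistanceMonoid {
  dm_sort :> orderType d;
  dzero : dm_sort;
  dplus : dm_sort -> dm_sort -> dm_sort;
  dplusA : associative dplus;
  dplusC : commutative dplus;
  dplus0 : left_id dzero dplus;
  dplus_le2r : forall t r s, (r <= s)%O -> (dplus r t <= dplus s t)%O;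
  dzero_le : forall r, (dzero <= r)%O
}.
Arguments dzero {d R} : rename.
Arguments dplus {d R} r s : rename.

Declare Scope dist_scope.
Delimit Scope dist_scope with D.
Notation "0" := dzero : dist_scope.
Notation "r + s" := (dplus r s) : dist_scope.

Record metricSpace d (R : distanceMonoid d) := MetricSpace {
  point :> Type;
  dist : point -> point -> R;
  dist_sym : forall x y, dist x y = dist y x;
  dist_eq0 : forall x y, dist x y = 0%D <-> x = y;
  dist_triangle : forall x y z, (dist x z <= (dist x y + dist y z)%D)%O
}.

Definition isometric_map d (R : distanceMonoid d) (A B : metricSpace R)
    (f : A -> B) : Prop :=
  forall x y, dist (f x) (f y) = dist x y.

(* An isometry between finite subspaces is given by two enumerations
   [a_i |-> b_i] with the same distances; repetitions are harmless. *)
Definition ultrahomogeneous d (R : distanceMonoid d) (U : metricSpace R)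
    : Prop :=
  forall (n : nat) (a b : 'I_n -> U),
    (forall i j, dist (a i) (a j) = dist (b i) (b j)) ->
    exists f : U -> U,
      [/\ isometric_map f, bijective f & forall i, f (a i) = b i].

Definition urysohn_space d (R : distanceMonoid d) (U : metricSpace R)
    : Prop :=
  [/\ countable [set: U],
      ultrahomogeneous U
    & forall A : metricSpace R, finite_set [set: A] ->
        exists f : A -> U, isometric_map f].

(* Relational signatures.  The argument places of a symbol form a finite type.
   A function symbol is represented by its graph. *)
Record signature := Signature {
  sorts : Type;
  symb : Type;
  arity : symb -> finType;
  argsort : forall P : symb, arity P -> sorts
}.

(* [V s] is the type of variables of sort [s]; [extend V t] adds one fresh
   variable, of sort [t]. *)
Inductive extend (S : Type) (V : S -> Type) (t : S) : S -> Type :=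
| Fresh : extend V t t
| Old s : V s -> extend V t s.
Arguments Fresh {S V t}.
Arguments Old {S V t s} _.

Inductive formula (L : signature) (V : sorts L -> Type) : Type :=
| Bot
| Equal (s : sorts L) (x y : V s)
| Atom (P : symb L) (x : forall i : arity P, V (argsort i))
| Imp (f g : formula V)
| All (t : sorts L) (f : formula (extend V t)).
Arguments Bot {L V}.
Arguments Equal {L V s} x y.
Arguments Atom {L V} P x.
Arguments All {L V} t f.

Fixpoint quantifier_free (L : signature) (V : sorts L -> Type) (f : formula V)
    : Prop :=
  match f with
  | Imp f g => quantifier_free f /\ quantifier_free g
  | All _ _ => False
  | _ => True
  end.

Record structure (L : signature) := Structure {
  dom :> sorts L -> Type;
  interp : forall P : symb L, (forall i : arity P, dom (argsort i)) -> Prop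
}.
Arguments interp {L} s P x.

Definition valuation (L : signature) (V : sorts L -> Type) (M : structure L) :=
  forall s, V s -> M s.

Definition extend_val (L : signature) (V : sorts L -> Type) (M : structure L)
    (v : valuation V M) (t : sorts L) (a : M t) : valuation (extend V t) M :=
  fun s x =>
    match x in extend _ _ s return M s with
    | Fresh => a
    | Old _ y => v _ y
    end.

Fixpoint sat (L : signature) (M : structure L) (V : sorts L -> Type)
    (v : valuation V M) (f : formula V) : Prop :=
  match f with
  | Bot => False
  | Equal _ x y => v _ x = v _ y
  | Atom P x => interp M P (fun i => v _ (x i))
  | Imp f g => sat v f -> sat v g
  | All t f => forall a : M t, sat (extend_val v a) f
  end.

Definition no_var (L : signature) : sorts L -> Type := fun=> void.
Definition sentence (L : signature) := formula (no_var (L := L)).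
Definition no_val (L : signature) (M : structure L) : valuation (no_var (L := L)) M :=
  fun _ (x : void) => match x with end.

Definition Th (L : signature) (M : structure L) : set (sentence L) :=
  [set f | sat (no_val M) f].

Definition models (L : signature) (T : set (sentence L)) (M : structure L)
    : Prop :=
  T `<=` Th M.

Definition params (L : signature) (M : structure L) := forall s, set (M s).

(* Formulas with parameters in [A] are formulas whose variables include the
   elements of [A], evaluated under the tautological valuation. *)
Definition param_var (L : signature) (M : structure L) (A : params M)
    : sorts L -> Type := fun s => A s.

Definition param_val (L : signature) (M : structure L) (A : params M)
    : valuation (param_var A) M := fun s x => sval x.
Arguments param_val {L M} A s _.

Definition solutions (L : signature) (M : structure L) (A : params M)
    (t : sorts L) (f : formula (extend (param_var A) t)) : set (M t) :=
  [set b | sat (extend_val (param_val A) b) f].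

Definition acl (L : signature) (M : structure L) (A : params M) : params M :=
  fun t => [set b | exists f : formula (extend (param_var A) t),
                      solutions f b /\ finite_set (solutions f)].

Definition dcl (L : signature) (M : structure L) (A : params M) : params M :=
  fun t => [set b | exists f : formula (extend (param_var A) t),
                      solutions f = [set b]].

Arguments acl {L M} A s _.
Arguments dcl {L M} A s _.

Definition card_lt (S T : Type) : Prop :=
  [set: S] #<= [set: T] /\ ~ ([set: T] #<= [set: S]).

(* Cardinals are represented by types. *)
Definition small (K : Type) (L : signature) (M : structure L) (A : params M)
    : Prop :=
  card_lt {s & A s} K.

Definition saturated (K : Type) (L : signature) (M : structure L) : Prop :=
  forall (A : params M), small K A ->
  forall (t : sorts L) (p : set (formula (extend (param_var A) t))),
    (forall q : set (formula (extend (param_var A) t)),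
       q `<=` p -> finite_set q -> exists b, forall f, q f -> solutions f b) ->
    exists b, forall f, p f -> solutions f b.

Definition elementary_map (L : signature) (M : structure L) (A : params M)
    (h : valuation (param_var A) M) : Prop :=
  forall f : formula (param_var A), sat (param_val A) f <-> sat h f.

Definition automorphism (L : signature) (M : structure L)
    (g : forall s, M s -> M s) : Prop :=
  (forall s, bijective (g s)) /\
  (forall P x, interp M P x <-> interp M P (fun i => g _ (x i))).

Definition strongly_homogeneous (K : Type) (L : signature) (M : structure L)
    : Prop :=
  forall (A : params M), small K A ->
  forall h : valuation (param_var A) M, elementary_map h ->
    exists2 g : forall s, M s -> M s,
      automorphism g & forall s (a : A s), g s (sval a) = h s a.

(* Saturated and strongly homogeneous for some cardinal
   [kappa > |L| + aleph_0]. *)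
Definition monster_model (L : signature) (T : set (sentence L))
    (M : structure L) : Prop :=
  models T M /\
  exists K : Type,
    [/\ card_lt (sorts L + symb L + nat) K, saturated K M
      & strongly_homogeneous K M].

Record language := Language {
  rsymb : Type;
  rarity : rsymb -> finType
}.

Definition one_sorted (L : language) : signature :=
  @Signature unit (rsymb L) (@rarity L) (fun _ _ => tt).
Coercion one_sorted : language >-> signature.

Definition quantifier_elimination (L : language) (T : set (sentence L))
    : Prop :=
  forall (n : nat) (f : formula (L := L) (fun=> 'I_n)),
    exists2 g : formula (L := L) (fun=> 'I_n), quantifier_free g &
      forall M : structure L, models T M ->
      forall v : valuation _ M, sat v f <-> sat v g.

Section Imaginaries.
Variables (L : language) (M : structure L).

Definition pair_val (n : nat) (a b : 'I_n -> M tt)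
    : valuation (L := L) (fun=> ('I_n + 'I_n)%type) M :=
  fun s => match s with tt => fun x =>
    match x with inl i => a i | inr j => b j end
  end.

(* Equivalence is required in [M], hence in every model of [Th M].  Two
   formulas defining the same relation are kept apart. *)
Record eq_formula := EqFormula {
  eqf_dim : nat;
  eqf_form : formula (L := L) (fun=> ('I_eqf_dim + 'I_eqf_dim)%type);
  eqf_equiv : RelationClasses.Equivalence
    (fun a b : 'I_eqf_dim -> M tt => sat (pair_val a b) eqf_form)
}.

Definition eqf_class (E : eq_formula) (a : 'I_(eqf_dim E) -> M tt)
    : set ('I_(eqf_dim E) -> M tt) :=
  [set b | sat (pair_val a b) (eqf_form E)].

(* The language of [M^eq]: the home sort [None], a sort [Some E] for every
   0-definable equivalence relation [E] on some [M^n], the symbols of [L] on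
   the home sort and, for each [E], the graph of the projection
   [M^n -> M^n / E], whose value is the argument at place [None]. *)
Definition eq_symb : Type := (rsymb L + eq_formula)%type.

Definition eq_arity (P : eq_symb) : finType :=
  match P with
  | inl P => rarity P
  | inr E => option 'I_(eqf_dim E)
  end.

Definition eq_argsort (P : eq_symb) : eq_arity P -> option eq_formula :=
  match P with
  | inl P => fun=> None
  | inr E => fun i => if i is Some _ then None else Some E
  end.

Definition eq_signature : signature :=
  @Signature (option eq_formula) eq_symb eq_arity eq_argsort.

Definition eq_dom (s : sorts eq_signature) : Type :=
  match s with
  | None => M tt
  | Some E => range (@eqf_class E)
  end.

Definition eq_interp (P : symb eq_signature)
    : (forall i : arity P, eq_dom (argsort i)) -> Prop :=
  match P with
  | inl P => fun x => interp M P x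
  | inr E => fun x =>
      sval (x None) = eqf_class (fun i : 'I_(eqf_dim E) => x (Some i))
  end.

Definition Meq : structure eq_signature := Structure eq_interp.

Definition imaginary_set (s : sorts eq_signature) (e : Meq s) : params Meq :=
  fun t => [set x | existT Meq t x = existT Meq s e].

Definition tuple_set (m : nat) (c : 'I_m -> M tt) : params Meq :=
  fun t => match t with None => range c | Some _ => set0 end.

Definition weak_canonical_parameter (s : sorts eq_signature) (e : Meq s)
    (m : nat) (c : 'I_m -> M tt) : Prop :=
  (forall i, acl (imaginary_set e) None (c i)) /\
  dcl (tuple_set c) s e.

(* Meant for [M] a monster model; the theory is then [Th M]. *)
Definition weak_elimination_of_imaginaries : Prop :=
  forall (s : sorts eq_signature) (e : Meq s),
    exists (m : nat) (c : 'I_m -> M tt), weak_canonical_parameter e c.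

End Imaginaries.

(* The symbol [r] stands for the binary relation [d(x,y) <= r]. *)
Definition L_dist d (R : distanceMonoid d) : language :=
  @Language R (fun=> 'I_2).

Definition metric_structure d (R : distanceMonoid d) (A : metricSpace R)
    : structure (L_dist R) :=
  @Structure (L_dist R) (fun=> A)
    (fun r x => (dist (x ord0) (x ord_max) <= r)%O).

(* The R-Urysohn space is unique up to isometry, so it does not matter which
   copy is used. *)
Definition urysohn_monoid d (R : distanceMonoid d) : Prop :=
  countable [set: R] /\
  forall U : metricSpace R, urysohn_space U ->
    quantifier_elimination (Th (metric_structure U)).

(* Main.v *)
Require Import Defs.
From mathcomp Require Import all_boot all_order.
From mathcomp Require Import boolp classical_sets functions cardinality.

(** The symbols of the language are the relations d(x,y) <= r.  A model of the
theory need not have distances in R, but a first-order property of these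
relations passes from the Urysohn space U, where distances can be computed
with, to the monster model M ([transfer]); everything about M is obtained in
this way, so that no completion of R is introduced.

An idempotent r makes d(x,y) <= r an equivalence relation, and its classes are
imaginaries.  Let r be neither 0 nor maximal.  No real point c is algebraic
over the class of a: since r is not 0 the representative a can be chosen
different from c, infinitely many points y have the same relations to a as c
([realize_type], by saturation), and quantifier elimination and homogeneity
give an automorphism which fixes a, hence its class, and moves c to y.  A weak
canonical parameter of the class would therefore be the empty tuple; but there
are at least two classes and automorphisms permute them transitively.

For the converse, quantifier elimination is first turned into a property of
addition ([absorb_max]).  In U the balls of radius r around x and y coincide
exactly when r + d(x,y) = r.  This is a first-order condition on x and y, so by
quantifier elimination the set of s with r + s = r is cut out by finitely many
elements of R.  It is an initial segment closed under addition, hence of the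
form [0,t] with t idempotent, unless it is all of R and r is maximal.  Without
idempotents other than 0 and the maximum, r + s > r whenever s is not 0 and r
is not maximal.

Let S be a class of a definable equivalence relation.  By quantifier
elimination there are a finite list D in R and a finite set P of points such
that whether x is in S depends only on which relations d <= r, for r in D, hold
among the entries of x and between x and P; then P supports S.  The heart of
the proof is [supports_inter]: if PA and PB support S, so does their
intersection C.  Hence a support of S with the least number of points is unique
as a set.  Its points are then algebraic over S, which is definable from them,
so they form a weak canonical parameter ([class_weak_canonical]).

To prove [supports_inter], let x be a tuple of points of U.  Round every
distance among the entries of x and from x to PA up to the next element of D,
then move x as far away as these distances allow: the new distances are those
of shortest paths, and they are realized in U.  The relations over PA with
bounds in D have not changed, so membership in S has not.  Do the same with PB,
then with PA again, and so on.  After a move over PA, a shortest path from x to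
a point of PB which avoids C has to step from PA to a different point; as
r + s > r, its length exceeds the element of D reached by the move before, and
the next rounding goes to a higher one ([far_step]).  After
more moves than D has elements only the points of C restrain x.  The position
reached depends only on the relations of x over C with bounds in D, so these
decide whether x is in S ([supports_free]). *)

Set Implicit Arguments.
Unset Strict Implicit.
Unset Printing Implicit Defensive.

Import Order.TTheory.

Local Open Scope order_scope.

(** * Distance monoids *)
Section Monoid.
Context {d : Order.disp_t} {R : distanceMonoid d}.
Implicit Types r s t : R.

Lemma dplus0r : right_id 0%D (@dplus d R).
Proof. by move=> r; rewrite dplusC dplus0. Qed.

Lemma dplus_le r r' s s' : r <= r' -> s <= s' -> (r + s)%D <= (r' + s')%D.
Proof.
move=> hr hs; apply: (le_trans (dplus_le2r s hr)).
by rewrite dplusC [X in _ <= X]dplusC dplus_le2r.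
Qed.

Lemma le_dplusl r s : r <= (r + s)%D.
Proof. by rewrite -{1}[r]dplus0r dplus_le // dzero_le. Qed.

Lemma le_dplusr r s : s <= (r + s)%D.
Proof. by rewrite dplusC le_dplusl. Qed.

Lemma dist_xx (A : metricSpace R) (x : A) : dist x x = 0%D.
Proof. exact/dist_eq0. Qed.

Lemma le_dzero r : (r <= 0%D) = (r == 0%D).
Proof. by rewrite eq_le dzero_le andbT. Qed.

Lemma dplus_minr r s t :
  (r + Order.min s t)%D = Order.min (r + s)%D (r + t)%D.
Proof.
have [st|/ltW ts] := leP s t; [rewrite min_l|rewrite min_r] => //;
  exact: dplus_le.
Qed.

Lemma dplus_minl r s t :
  (Order.min s t + r)%D = Order.min (s + r)%D (t + r)%D.
Proof. by rewrite ![(_ + r)%D]dplusC dplus_minr. Qed.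

Lemma seq_max (P : pred R) (l : seq R) r : P r ->
  exists m, P m /\ forall s, s \in l -> P s -> s <= m.
Proof.
move=> Pr; elim: l => [|a l [m [Pm hm]]]; first by exists r.
have [Pa|nPa] := boolP (P a); last first.
  exists m; split=> // s; rewrite inE => /orP[/eqP->|/hm//].
  by rewrite (negPf nPa).
exists (Order.max a m); split; first by rewrite maxElt; case: ifP.
move=> s; rewrite inE le_max => /orP[/eqP->|/hm h /h->]; first by rewrite lexx.
by rewrite orbT.
Qed.

Lemma seq_min (P : pred R) (l : seq R) r : P r ->
  exists m, P m /\ forall s, s \in l -> P s -> m <= s.
Proof.
move=> Pr; elim: l => [|a l [m [Pm hm]]]; first by exists r.
have [Pa|nPa] := boolP (P a); last first.
  exists m; split=> // s; rewrite inE => /orP[/eqP->|/hm//].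
  by rewrite (negPf nPa).
exists (Order.min a m); split; first by rewrite minElt; case: ifP.
move=> s; rewrite inE ge_min => /orP[/eqP->|/hm h /h->]; first by rewrite lexx.
by rewrite orbT.
Qed.

Lemma seq_ub (l : seq R) : exists N, forall s, s \in l -> s <= N.
Proof.
have [N [_ hN]] := @seq_max predT l 0%D isT.
by exists N => s sl; apply: hN.
Qed.

End Monoid.

(** * Shortest paths *)

Section Closure.
Context {d : Order.disp_t} {R : distanceMonoid d}.
Variables (Z : finType) (w : Z -> Z -> R).

(** Floyd and Warshall's recursion: the points of [s] are allowed as intermediate
stops.  It avoids reducing walks to simple paths, and both bounds on the result
that are used below go through it by induction. *)
Fixpoint through (s : seq Z) (x y : Z) : R :=
  if s is k :: s' then
    Order.min (through s' x y) (through s' x k + through s' k y)%D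
  else w x y.

Definition path_dist := through (enum Z).

Lemma through_le s x y : through s x y <= w x y.
Proof. by elim: s x y => //= k s IH x y; rewrite ge_min IH. Qed.

Lemma path_dist_le x y : path_dist x y <= w x y.
Proof. exact: through_le. Qed.

(** The only lower bound on shortest paths: a function that drops by at most the
weight along every edge drops by at most the length along every path.  Lengths
of paths are estimated by choosing a potential, without mentioning paths. *)
Lemma path_dist_potential (phi : Z -> R) :
  (forall x y, phi x <= (w x y + phi y)%D) ->
  forall x y, phi x <= (path_dist x y + phi y)%D.
Proof.
move=> hphi; rewrite /path_dist; elim: (enum Z) => //= k s IH x y.
rewrite dplus_minl le_min IH -dplusA.
by apply: (le_trans (IH x k)); apply: dplus_le.
Qed.

Hypothesis w0 : forall x, w x x = 0%D.
Hypothesis wC : forall x y, w x y = w y x.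

Lemma through0 s x : through s x x = 0%D.
Proof. by apply/eqP; rewrite -le_dzero -(w0 x) through_le. Qed.

Lemma throughC s x y : through s x y = through s y x.
Proof.
by elim: s x y => //= k s IH x y; rewrite IH dplusC ![through s _ k]IH.
Qed.

(** A detour through the point added last uses it twice, and removing the loop
between the two visits shortens it. *)
Lemma through_triangle s k x y : k \in s ->
  through s x y <= (through s x k + through s k y)%D.
Proof.
elim: s k x y => //= k0 s IH k x y; rewrite inE => /orP[/eqP->|ks].
  by rewrite !through0 dplus0 dplus0r !minxx ge_min lexx orbT.
have IHk a b := IH k a b ks.
rewrite dplus_minr !dplus_minl !le_min !ge_min IHk /=.
apply/and3P; split.
- apply/orP; right; rewrite -dplusA; apply: dplus_le => //.
- apply/orP; right; rewrite dplusA; apply: dplus_le => //.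
- apply/orP; right; rewrite dplusA; apply: dplus_le => //.
  by rewrite -dplusA le_dplusl.
Qed.

Lemma path_distC x y : path_dist x y = path_dist y x.
Proof. exact: throughC. Qed.

Lemma path_dist0 x : path_dist x x = 0%D.
Proof. exact: through0. Qed.

Lemma path_dist_triangle x y z :
  path_dist x z <= (path_dist x y + path_dist y z)%D.
Proof. by apply: through_triangle; rewrite mem_enum. Qed.

End Closure.

(** * Rounding up to finitely many values *)

Section Rounding.
Context {d : Order.disp_t} {R : distanceMonoid d}.
Variables (D : seq R) (N : R).
Implicit Types r s : R.

(** [N] stands for an infinite distance: R need not have a maximum, and a bound
for the finitely many distances at hand serves as well. *)
Definition round_up r : R := foldr Order.min N [seq s <- D | r <= s].

Lemma round_upE r s :
  (forall t, t \in D -> (r <= t) = (s <= t)) -> round_up r = round_up s.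
Proof. by move=> h; rewrite /round_up; congr foldr; apply: eq_in_filter. Qed.

Lemma round_up_mem r : round_up r \in N :: [seq s <- D | r <= s].
Proof.
rewrite /round_up; elim: filter => [|a l IH] /=; first by rewrite inE.
rewrite minElt; case: ifP => _; rewrite !inE ?eqxx ?orbT //.
by move: IH; rewrite inE => /orP[->//|->]; rewrite !orbT.
Qed.

Lemma le_round_up r : r <= N -> r <= round_up r.
Proof.
move=> rN; have := round_up_mem r.
by rewrite inE mem_filter => /orP[/eqP->|/andP[]].
Qed.

Lemma round_up_le r s : s \in D -> r <= s -> round_up r <= s.
Proof.
move=> sD rs; have : s \in [seq s <- D | r <= s] by rewrite mem_filter rs.
rewrite /round_up; elim: filter => //= a l IH; rewrite inE ge_min.
by case/orP => [/eqP->|/IH->]; rewrite ?lexx ?orbT.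
Qed.

Lemma round_up_leN r : round_up r <= N.
Proof.
by rewrite /round_up; elim: filter => //= a l IH; rewrite ge_min IH orbT.
Qed.

(** Any value between a distance and its rounding satisfies the same relations
with bounds in [D]; this is why distances may be increased that far. *)
Lemma round_up_between r s : r <= s -> s <= round_up r ->
  forall t, t \in D -> (r <= t) = (s <= t).
Proof.
move=> rs sr t tD; apply/idP/idP => [rt|]; last exact: le_trans.
exact/(le_trans sr)/round_up_le.
Qed.

(** The elements of [D] in increasing order, followed by [N] for ever. *)
Definition level n := nth N (sort <=%O D) n.

Hypothesis DN : forall t, t \in D -> t <= N.

Lemma level_mono m n : (m <= n)%N -> level m <= level n.
Proof.
move=> mn; rewrite /level.
have [nD|Dn] := ltnP n (size (sort <=%O D)).
  have := sort_le_sorted D; move/(sorted_leq_nth le_trans le_refl N).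
  by apply; rewrite ?inE // (leq_ltn_trans mn).
rewrite [X in _ <= X]nth_default //.
have [mD|Dm] := ltnP m (size (sort <=%O D)); last by rewrite nth_default.
by apply: DN; rewrite -(mem_sort <=%O) mem_nth.
Qed.

(** Exceeding the first [n] elements of [D] suffices for the rounding to reach the
next one: this is how one move gains one level. *)
Lemma level_round_up n r : r <= N -> (forall m, (m < n)%N -> level m < r) ->
  level n <= round_up r.
Proof.
move=> rN h; have := le_round_up rN; have := round_up_mem r.
rewrite inE mem_filter => /orP[/eqP-> _|/andP[_]].
  rewrite -[X in _ <= X](@nth_default _ N (sort <=%O D) (maxn n (size D))).
    by apply: level_mono; rewrite leq_maxl.
  by rewrite size_sort leq_maxr.
rewrite -(mem_sort <=%O) => /(nthP N)[m mD mr]; rewrite -mr => rm.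
apply: level_mono; rewrite leqNgt; apply/negP => /h.
by rewrite /level ltNge rm.
Qed.

Lemma level_size : level (size D) = N.
Proof. by rewrite /level nth_default ?size_sort. Qed.

End Rounding.

(** * Extending finite configurations in the Urysohn space *)

Section Realize.
Context {d : Order.disp_t} {R : distanceMonoid d}.

(** Amalgams are first found as pseudometrics, since points that are given
different names may coincide. *)
Section Quotient.
Variables (Z : finType) (rho : Z -> Z -> R).
Hypothesis rho0 : forall x, rho x x = 0%D.
Hypothesis rhoC : forall x y, rho x y = rho y x.
Hypothesis rhoD : forall x y z, rho x z <= (rho x y + rho y z)%D.

Lemma rho_congr x y z : rho x y = 0%D -> rho x z = rho y z.
Proof.
move=> xy; apply/eqP; rewrite eq_le.
have := rhoD x y z; rewrite xy dplus0 => ->.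
by have := rhoD y x z; rewrite (rhoC y x) xy dplus0 => ->.
Qed.

(** [pick] depends only on the extension of the class, so equivalent points get
the same representative. *)
Definition rep z := odflt z [pick y | rho z y == 0%D].

Lemma rho_rep z : rho z (rep z) = 0%D.
Proof. by rewrite /rep; case: pickP => [y /eqP|]. Qed.

Lemma rep_eq x y : rho x y = 0%D -> rep x = rep y.
Proof.
move=> xy; rewrite /rep.
have -> : [pick z | rho x z == 0%D] = [pick z | rho y z == 0%D].
  by apply: eq_pick => z; rewrite (rho_congr z xy).
by case: pickP => //= /(_ y); rewrite rho0 eqxx.
Qed.

Definition quotient_point := {z : Z | rep z == z}.

Definition quotient_dist (x y : quotient_point) := rho (sval x) (sval y).

Lemma quotient_dist_eq0 x y : quotient_dist x y = 0%D <-> x = y.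
Proof.
split=> [|->]; last exact: rho0.
case: x y => [x hx] [y hy] /rep_eq /= e; apply: val_inj => /=.
by rewrite -(eqP hx) -(eqP hy).
Qed.

Definition quotient_space : metricSpace R :=
  @MetricSpace d R quotient_point quotient_dist (fun x y => rhoC _ _)
    quotient_dist_eq0 (fun x y z => rhoD _ _ _).

Lemma rep_idem z : rep (rep z) == rep z.
Proof. by rewrite -(rep_eq (rho_rep z)). Qed.

Definition quotient_map z : quotient_space := exist _ (rep z) (rep_idem z).

Lemma quotient_mapE x y : dist (quotient_map x) (quotient_map y) = rho x y.
Proof.
rewrite /= /quotient_dist /= -(rho_congr _ (rho_rep x)) rhoC.
by rewrite -(rho_congr _ (rho_rep y)) rhoC.
Qed.

Lemma quotient_finite : finite_set [set: quotient_space]%classic.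
Proof. exact: (@finite_finset quotient_point). Qed.

End Quotient.

Variable U : metricSpace R.
Hypothesis hU : urysohn_space U.

Lemma urysohn_realize (Z : finType) (rho : Z -> Z -> R) :
  (forall x, rho x x = 0%D) -> (forall x y, rho x y = rho y x) ->
  (forall x y z, rho x z <= (rho x y + rho y z)%D) ->
  exists h : Z -> U, forall x y, dist (h x) (h y) = rho x y.
Proof.
move=> r0 rC rD; have [_ _ univ] := hU.
have [F hF] := univ (quotient_space r0 rC rD) (quotient_finite r0 rC rD).
by exists (F \o quotient_map r0 rC rD) => x y /=; rewrite hF quotient_mapE.
Qed.

(** Universality yields a copy of the whole configuration, and homogeneity moves
the part indexed by [T] back to its given position. *)
Lemma urysohn_extend (I T : finType) (k : T -> U)
    (rho : I + T -> I + T -> R) :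
  (forall x, rho x x = 0%D) -> (forall x y, rho x y = rho y x) ->
  (forall x y z, rho x z <= (rho x y + rho y z)%D) ->
  (forall s t, rho (inr s) (inr t) = dist (k s) (k t)) ->
  exists y : I -> U, (forall i j, dist (y i) (y j) = rho (inl i) (inl j)) /\
    forall i t, dist (y i) (k t) = rho (inl i) (inr t).
Proof.
move=> r0 rC rD rk; have [h hh] := urysohn_realize r0 rC rD.
have [_ homog _] := hU.
have [] := homog #|T| (fun i => h (inr (enum_val i))) (fun i => k (enum_val i)).
  by move=> i j; rewrite hh rk.
move=> f [fiso _ fk]; exists (fun i => f (h (inl i))); split=> [i j|i t].
  by rewrite fiso hh.
by rewrite -(enum_rankK t) -fk fiso hh.
Qed.

End Realize.

(** * Intersecting supports *)

Section Support.
Context {d : Order.disp_t} {R : distanceMonoid d}.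

(** The type of a tuple over [P], as far as formulas with bounds in [D] can see.
The relation [le] is abstract because the notion is used in the Urysohn space,
in the monster model and on the home sort of its imaginaries. *)
Definition same_type (X : Type) (le : R -> X -> X -> Prop) (D : seq R)
    (I : Type) (P : X -> Prop) (x y : I -> X) : Prop :=
  (forall i j r, r \in D -> (le r (x i) (x j) <-> le r (y i) (y j))) /\
  (forall u, P u -> forall i r, r \in D -> (le r (x i) u <-> le r (y i) u)).

Definition supports X le D I (P : X -> Prop) (S : (I -> X) -> Prop) : Prop :=
  forall x y, @same_type X le D I P x y -> (S x <-> S y).

Variables (U : metricSpace R) (D : seq R).
Hypothesis hU : urysohn_space U.
Hypothesis D0 : 0%D \in D.
Hypothesis absorb : forall r s : R,
  (r + s)%D = r -> s <> 0%D -> forall t : R, t <= r.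

Let le_U r (x y : U) := is_true (dist x y <= r).
Variables (I T : finType) (k : T -> U).
Let Z : finType := (I + T)%type.

Section Bound.
Variable N : R.
Hypothesis DN : forall r, r \in D -> r <= N.
Hypothesis kN : forall s t, dist (k s) (k t) <= N.
Local Notation up := (round_up D N).

Definition pt (y : I -> U) (z : Z) : U :=
  match z with inl i => y i | inr t => k t end.

(** The weights whose shortest paths give the position furthest from the points
[k t] that has the same type as [y] over [P] up to [D]. *)
Definition relaxed (P : U -> Prop) (y : I -> U) (z z' : Z) : R :=
  match z, z' with
  | inl i, inl j => up (dist (y i) (y j))
  | inl i, inr t | inr t, inl i =>
      if `[< P (k t) >] then up (dist (y i) (k t)) else N
  | inr s, inr t => dist (k s) (k t)
  end.

Definition bounded y := forall z z', dist (pt y z) (pt y z') <= N.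

Lemma relaxed0 P y z : relaxed P y z z = 0%D.
Proof.
case: z => [i|t] /=; rewrite dist_xx //.
by apply/eqP; rewrite -le_dzero; apply: round_up_le.
Qed.

Lemma relaxedC P y z z' : relaxed P y z z' = relaxed P y z' z.
Proof. by case: z z' => [i|t] [j|s] //=; rewrite dist_sym. Qed.

Lemma relaxed_leN P y z z' : relaxed P y z z' <= N.
Proof.
by case: z z' => [i|t] [j|s] //=; try case: ifP => _; rewrite ?round_up_leN.
Qed.

Lemma dist_le_relaxed P y : bounded y ->
  forall z z', dist (pt y z) (pt y z') <= relaxed P y z z'.
Proof.
move=> hy [i|t] [j|s] /=.
- exact/le_round_up/(hy (inl i) (inl j)).
- case: ifP => _; last exact: (hy (inl i) (inr s)).
  exact/le_round_up/(hy (inl i) (inr s)).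
- rewrite dist_sym; case: ifP => _; last exact: (hy (inl j) (inr t)).
  exact/le_round_up/(hy (inl j) (inr t)).
- exact: lexx.
Qed.

Lemma dist_le_path P y : bounded y ->
  forall z z', dist (pt y z) (pt y z') <= path_dist (relaxed P y) z z'.
Proof.
move=> hy z z'; rewrite -[X in _ <= X]dplus0r -(dist_xx (pt y z')).
apply: (path_dist_potential (w := relaxed P y)
         (phi := fun x => dist (pt y x) (pt y z'))) => a b.
apply: (le_trans (dist_triangle _ (pt y b) _)).
by rewrite dplus_le2r ?dist_le_relaxed.
Qed.

Lemma relaxed_eq P y y' :
  (forall i j t, t \in D ->
    (dist (y i) (y j) <= t) = (dist (y' i) (y' j) <= t)) ->
  (forall i s, P (k s) -> forall t, t \in D ->
    (dist (y i) (k s) <= t) = (dist (y' i) (k s) <= t)) ->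
  relaxed P y = relaxed P y'.
Proof.
move=> h1 h2; apply/funext => -[i|t]; apply/funext => -[j|s] //=.
- by apply: round_upE => t tD; apply: h1.
- by case: asboolP => // Ps; apply: round_upE => t tD; apply: h2.
- by case: asboolP => // Ps; apply: round_upE => r rD; apply: h2.
Qed.

(** Shortest paths lie between the old distances and the relaxed weights.  On the
points [k t] the two agree, so these need not move, and elsewhere they have the
same rounding, so the type over [P] does not change. *)
Lemma free_move P y : bounded y -> exists y', [/\ bounded y',
  forall z z', dist (pt y' z) (pt y' z') = path_dist (relaxed P y) z z',
  forall C : U -> Prop, (forall u, C u -> P u) -> relaxed C y' = relaxed C y &
  forall t, (forall i j, t \in D ->
     (dist (y i) (y j) <= t) = (dist (y' i) (y' j) <= t)) /\
   forall i s, P (k s) -> t \in D ->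
    (dist (y i) (k s) <= t) = (dist (y' i) (k s) <= t)].
Proof.
move=> hy; set rho := path_dist (relaxed P y).
have rk s t : rho (inr s) (inr t) = dist (k s) (k t).
  apply/eqP; rewrite eq_le (path_dist_le (relaxed P y) (inr s) (inr t)) /=.
  exact: (dist_le_path P hy (inr s) (inr t)).
have rC z z' : rho z z' = rho z' z by apply/path_distC/relaxedC.
have [y' [yy yk]] := urysohn_extend hU (path_dist0 (relaxed0 P y)) rC
  (path_dist_triangle (relaxed0 P y)) rk.
have hrho z z' : dist (pt y' z) (pt y' z') = rho z z'.
  by case: z z' => [i|s] [j|t] //=; rewrite ?yy ?yk // dist_sym yk rC.
have same : forall t, (forall i j, t \in D ->
     (dist (y i) (y j) <= t) = (dist (y' i) (y' j) <= t)) /\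
   forall i s, P (k s) -> t \in D ->
    (dist (y i) (k s) <= t) = (dist (y' i) (k s) <= t).
  move=> t; split=> [i j|i s Ps] tD; apply: (round_up_between (N := N)) tD.
  - by have := dist_le_path P hy (inl i) (inl j); rewrite /= yy.
  - by rewrite yy; have := path_dist_le (relaxed P y) (inl i) (inl j).
  - by have := dist_le_path P hy (inl i) (inr s); rewrite /= yk.
  - rewrite yk; have := path_dist_le (relaxed P y) (inl i) (inr s).
    by rewrite /=; case: asboolP.
exists y'; split=> //.
- move=> z z'; rewrite hrho.
  exact/(le_trans (path_dist_le _ _ _))/relaxed_leN.
- move=> C CP; symmetry; apply: relaxed_eq => [i j t tD|i s Cs t tD].
    by case: (same t) => h _; apply: h.
  by case: (same t) => _ h; apply: h => //; apply: CP.
Qed.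

Section Alternate.
Variables (C : U -> Prop) (x : I -> U).
Hypothesis hx : bounded x.
Local Notation G := (path_dist (relaxed C x)).

(** A common lower bound of the distances between different points.  It can be 0
only when R is trivial, where every conclusion about distances is immediate. *)
Lemma gap : exists dl : R,
  (forall s t, k s <> k t -> dl <= dist (k s) (k t)) /\
  (dl = 0%D -> forall r : R, r = 0%D).
Proof.
have [[r /eqP r0]|h] := pselect (exists r : R, r <> 0%D); last first.
  exists 0%D; split=> [*|_ r]; first exact: dzero_le.
  by apply: contrapT => r0; apply: h; exists r.
pose f (p : T * T) := dist (k p.1) (k p.2).
have [dl [dl0 hdl]] := seq_min (codom f) (r0 : (fun s => s != 0%D) r).
exists dl; split=> [s t st|e]; last by rewrite e eqxx in dl0.
apply: (hdl (f (s, t))); first exact: codom_f.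
by apply/eqP => /dist_eq0.
Qed.

(** One move over [PA] takes [y], which is at level [n] from [PA], to level
[n + 1] from [PB].  Consider where a path from an entry of [y] to a point of
[PB] enters the given points.  If it enters in [C], or where [y] is already at
free distance, it is no shorter than the free distance [G].  Otherwise it enters
at a point of [PA] outside [PB], where the weight is at least [level n], and
still has to leave that point.  The potential [phi] records both possibilities;
it is cut off at [level n + dl] on both sides so that paths may return to [y]. *)
Lemma far_step (PA PB : U -> Prop) n y y' :
  (forall u, C u <-> PA u /\ PB u) ->
  bounded y -> relaxed C y = relaxed C x ->
  (forall i t, PA (k t) -> G (inl i) (inr t) <= dist (y i) (k t) \/
     forall m, (m < n)%N -> level D N m < dist (y i) (k t)) ->
  (forall z z', dist (pt y' z) (pt y' z') = path_dist (relaxed PA y) z z') ->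
  forall i t, PB (k t) -> G (inl i) (inr t) <= dist (y' i) (k t) \/
     forall m, (m < n.+1)%N -> level D N m < dist (y' i) (k t).
Proof.
move=> hC hy yx IH hy' i u Bu.
have GE : G = path_dist (relaxed C y) by rewrite yx.
have [dl [hdl dl0]] := gap.
pose la := (level D N n + dl)%D.
have G_triangle := path_dist_triangle (relaxed0 C x).
have GN z z' : G z z' <= N.
  exact/(le_trans (path_dist_le _ _ _))/relaxed_leN.
have yG z z' : dist (pt y z) (pt y z') <= G z z' by rewrite GE dist_le_path.
pose phi z := match z with
  | inl j => Order.min (G (inl j) (inr u)) la
  | inr s => Order.min (dist (k s) (k u)) la end.
have hphi z z' : phi z <= (relaxed PA y z z' + phi z')%D.
  have la_r r : (phi z <= la) -> phi z <= (r + la)%D.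
    by move/le_trans; apply; apply: le_dplusr.
  have phila : phi z <= la by case: (z) => ? /=; rewrite ge_min lexx orbT.
  move: z' => [j|s] /=; rewrite dplus_minr le_min la_r // andbT.
  - case: z phila {la_r} => [j'|s'] phila /=; rewrite ge_min.
      apply/orP; left; apply: (le_trans (G_triangle _ (inl j) _)).
      apply: dplus_le => //; apply: (le_trans (path_dist_le _ _ _)).
      by rewrite -yx.
    apply/orP; left; apply: (le_trans (dist_triangle _ (y j) _)).
    apply: dplus_le; last exact: (yG (inl j) (inr u)).
    exact: (dist_le_relaxed PA hy (inr s') (inl j)).
  - case: z phila {la_r} => [j|s'] phila /=; last first.
      by rewrite ge_min dist_triangle.
    case: asboolP => As; last first.
      by rewrite ge_min (le_trans (GN _ _)) // le_dplusl.
    (* a point from which [y] is already at free distance adds no constraint *)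
    have far : G (inl j) (inr s) <= round_up D N (dist (y j) (k s)) ->
        Order.min (G (inl j) (inr u)) la <=
        (round_up D N (dist (y j) (k s)) + dist (k s) (k u))%D.
      move=> h; rewrite ge_min; apply/orP; left.
      apply: (le_trans (G_triangle _ (inr s) _)); apply: dplus_le => //.
      exact: (path_dist_le (relaxed C x) (inr s) (inr u)).
    have [Bs|nBs] := pselect (PB (k s)).
      apply: far; apply: (le_trans (path_dist_le _ _ _)); rewrite -yx /=.
      by case: asboolP => // -[]; apply/hC.
    have ysN := hy (inl j) (inr s).
    have [h|h] := IH j s As.
      by apply: far; apply: (le_trans h); apply: le_round_up.
    rewrite ge_min; apply/orP; right; apply: dplus_le.
      exact: level_round_up.
    by apply: hdl => su; apply: nBs; rewrite su.
have := path_dist_potential hphi (inl i) (inr u).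
rewrite -hy' /= dist_xx (min_l (dzero_le _)) dplus0r ge_min.
move=> /orP[h|h]; [by left|].
have [Gy|yG'] := leP (G (inl i) (inr u)) (dist (y' i) (k u)); [by left|right].
move=> m; rewrite ltnS => mn; apply: (le_lt_trans (level_mono DN mn)).
apply: (lt_le_trans _ h); rewrite lt_neqAle le_dplusl andbT; apply/eqP => e.
have [dl00|] := pselect (dl = 0%D).
  by move: yG'; rewrite (dl0 dl00 (G _ _)) ltNge dzero_le.
move/(absorb (esym e)) => hmax.
(* at the maximum of R nothing is gained, but [G] cannot be larger *)
move: yG'; rewrite ltNge => /negP; apply; apply: (le_trans (hmax _)).
exact: le_trans (le_dplusl _ dl) h.
Qed.

Lemma same_type_of_le (P : U -> Prop) (y y' : I -> U) :
  (forall u, P u -> exists t, k t = u) ->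
  (forall t i j, t \in D ->
     (dist (y i) (y j) <= t) = (dist (y' i) (y' j) <= t)) ->
  (forall t i s, P (k s) -> t \in D ->
    (dist (y i) (k s) <= t) = (dist (y' i) (k s) <= t)) ->
  same_type le_U D P y y'.
Proof.
move=> hP h1 h2; split=> [i j r rD|u Pu i r rD].
  by rewrite /le_U h1.
by have [t tu] := hP _ Pu; subst u; rewrite /le_U h2.
Qed.

(** The supports are exchanged at each step, since a move over one of them gains
a level from the other. *)
Lemma far_walk n (PA PB : U -> Prop) (S : (I -> U) -> Prop) :
  (forall u, C u <-> PA u /\ PB u) ->
  (forall u, PA u -> exists t, k t = u) ->
  (forall u, PB u -> exists t, k t = u) ->
  supports le_U D PA S -> supports le_U D PB S ->
  exists y, [/\ bounded y, relaxed C y = relaxed C x, S x <-> S y &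
    forall i t, PA (k t) -> G (inl i) (inr t) <= dist (y i) (k t) \/
     forall m, (m < n)%N -> level D N m < dist (y i) (k t)].
Proof.
elim: n PA PB => [|n IH] PA PB hC kA kB SA SB.
  by exists x; split=> // *; right.
have hC' u : C u <-> PB u /\ PA u by rewrite hC; split=> -[].
have [y [hy yx Sxy far]] := IH PB PA hC' kB kA SB SA.
have [y' [hy' yy' Cy' same]] := free_move PB hy.
exists y'; split=> //.
- by rewrite -yx; apply: Cy' => u /hC[].
- rewrite Sxy; apply: SB; apply: same_type_of_le => // t.
    by case: (same t).
  by case: (same t).
- exact: far_step hC' hy yx far yy'.
Qed.

End Alternate.

(** Beyond the last level the moved tuple is at free distance from [PA], so over
[PA] it has the same type as the tuple in free position over [C]. *)
Lemma supports_free (C PA PB : U -> Prop) (S : (I -> U) -> Prop) x xf :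
  (forall u, C u <-> PA u /\ PB u) ->
  (forall u, PA u -> exists t, k t = u) ->
  (forall u, PB u -> exists t, k t = u) ->
  supports le_U D PA S -> supports le_U D PB S -> bounded x ->
  (forall z z', dist (pt xf z) (pt xf z') = path_dist (relaxed C x) z z') ->
  S x <-> S xf.
Proof.
move=> hC kA kB SA SB hx hxf.
have [y [hy yx -> far]] := far_walk hx (size D).+1 hC kA kB SA SB.
have yG z z' : dist (pt y z) (pt y z') <= dist (pt xf z) (pt xf z').
  by rewrite hxf -yx dist_le_path.
apply: SA; apply: same_type_of_le => // t.
  move=> i j tD; apply: (round_up_between (N := N)) tD.
    exact: (yG (inl i) (inl j)).
  rewrite (hxf (inl i) (inl j)) -yx.
  exact: (path_dist_le (relaxed C y) (inl i) (inl j)).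
move=> i s As tD; congr (_ <= _); apply/eqP; rewrite eq_le.
rewrite (yG (inl i) (inr s)) (hxf (inl i) (inr s)) /=.
case: (far i s As) => // /(_ (size D) (ltnSn _)); rewrite level_size.
by rewrite ltNge (hy (inl i) (inr s)).
Qed.

End Bound.

(** Tuples of the same type over [C] have the same relaxed weights, hence the same
free position, and both can be moved there without leaving or entering [S]. *)
Lemma supports_inter (C PA PB : U -> Prop) (S : (I -> U) -> Prop) :
  (forall u, C u <-> PA u /\ PB u) ->
  (forall u, PA u -> exists t, k t = u) ->
  (forall u, PB u -> exists t, k t = u) ->
  supports le_U D PA S -> supports le_U D PB S -> supports le_U D C S.
Proof.
move=> hC kA kB SA SB x x' [sx sC].
pose dd y (p : Z * Z) := dist (pt y p.1) (pt y p.2).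
have [N hN] := seq_ub (D ++ codom (dd x) ++ codom (dd x')).
have DN r : r \in D -> r <= N by move=> h; apply: hN; rewrite mem_cat h.
have hx : bounded N x.
  move=> z z'; apply: hN; rewrite !mem_cat.
  by rewrite (codom_f (dd x) (z, z')) !orbT.
have hx' : bounded N x'.
  move=> z z'; apply: hN; rewrite !mem_cat.
  by rewrite (codom_f (dd x') (z, z')) !orbT.
have kN s t : dist (k s) (k t) <= N by exact: (hx (inr s) (inr t)).
have [xf [_ hxf _ _]] := free_move kN C hx.
have e : relaxed N C x = relaxed N C x'.
  apply: relaxed_eq => [i j t tD|i s Cs t tD].
    by have [h1 h2] := sx i j t tD; apply/idP/idP.
  by have [h1 h2] := sC _ Cs i t tD; apply/idP/idP.
rewrite (supports_free DN kN hC kA kB SA SB hx hxf).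
by rewrite e in hxf; rewrite (supports_free DN kN hC kA kB SA SB hx' hxf).
Qed.
End Support.

(** * Definable predicates *)

Section Rename.
Variable L : signature.

Definition lift_var (V W : sorts L -> Type) (f : forall s, V s -> W s) t s
    (x : extend V t s) : extend W t s :=
  match x in extend _ _ s return extend W t s with
  | Fresh => Fresh
  | Old _ y => Old (f _ y)
  end.

Fixpoint rename (V W : sorts L -> Type) (f : forall s, V s -> W s)
    (phi : formula V) : formula W :=
  match phi in formula _ return formula W with
  | Bot => Bot
  | Equal s x y => Equal (f _ x) (f _ y)
  | Atom P x => Atom P (fun i => f _ (x i))
  | Imp g h => Imp (rename f g) (rename f h)
  | All t g => All t (rename (lift_var f (t := t)) g)
  end.

Lemma sat_ext (M : structure L) V (v w : valuation V M) phi :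
  (forall s x, v s x = w s x) -> sat v phi <-> sat w phi.
Proof.
move=> h; have -> // : v = w.
apply: functional_extensionality_dep => s.
exact: functional_extensionality_dep.
Qed.

Lemma sat_rename (M : structure L) V W (f : forall s, V s -> W s) phi
    (w : valuation W M) :
  sat w (rename f phi) <-> sat (fun s x => w s (f s x)) phi.
Proof.
elim: phi W f w => [|V' s x y|V' P x|V' g IHg h IHh|V' t g IH] W f w //=.
  by rewrite IHg IHh.
split=> H a; move: (H a); rewrite IH; apply: iffLR; apply: sat_ext => s x;
  by case: x.
Qed.
End Rename.

Section Definable.
Variables (L : signature) (J : Type) (N : J -> structure L).
Implicit Types V W : sorts L -> Type.

(** Formulas are never written out: predicates on valuations are shown definable
by the closure properties below.  One formula has to serve all structures of
the family [N]; taking all structures of the signature gives sentences that can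
be transferred, and a constant family gives definability in one structure. *)
Definition definable V (P : forall j, valuation V (N j) -> Prop) : Prop :=
  exists f : formula V, forall j v, sat v f <-> P j v.

Lemma definable_ext V (P Q : forall j, valuation V (N j) -> Prop) :
  (forall j v, P j v <-> Q j v) -> definable P -> definable Q.
Proof. by move=> h [f hf]; exists f => j v; rewrite hf. Qed.

Lemma definable_rename V W (f : forall s, V s -> W s)
    (P : forall j, valuation V (N j) -> Prop) :
  definable P ->
  definable (fun j (w : valuation W (N j)) => P j (fun s x => w s (f s x))).
Proof. by move=> [g hg]; exists (rename f g) => j w; rewrite sat_rename hg. Qed.

Lemma definable_sat V W (f : forall s, V s -> W s) (g : formula V) :
  definable (fun j (w : valuation W (N j)) => sat (fun s x => w s (f s x)) g).
Proof. by exists (rename f g) => j w; rewrite sat_rename. Qed.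

Lemma definable_const V (Q : Prop) :
  definable (fun j (v : valuation V (N j)) => Q).
Proof.
have [q|nq] := pselect Q; last by exists Bot.
by exists (Imp Bot Bot) => j v /=; split.
Qed.

Lemma definable_eq V s (x y : V s) :
  definable (fun j (v : valuation V (N j)) => v s x = v s y).
Proof. by exists (Equal x y). Qed.

Lemma definable_atom V (P : symb L) (x : forall i : arity P, V (argsort i)) :
  definable (fun j (v : valuation V (N j)) =>
    interp (N j) P (fun i => v _ (x i))).
Proof. by exists (Atom P x). Qed.

Lemma definable_imp V (P Q : forall j, valuation V (N j) -> Prop) :
  definable P -> definable Q -> definable (fun j v => P j v -> Q j v).
Proof. by move=> [f hf] [g hg]; exists (Imp f g) => j v /=; rewrite hf hg. Qed.

Lemma definable_all V t (P : forall j, valuation V (N j) -> N j t -> Prop) :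
  definable (fun j (w : valuation (extend V t) (N j)) =>
               P j (fun s x => w s (Old x)) (w t Fresh)) ->
  definable (fun j v => forall a, P j v a).
Proof.
move=> [f hf]; exists (All t f) => j v /=.
by split=> H a; move: (H a); rewrite hf.
Qed.

Lemma definable_not V (P : forall j, valuation V (N j) -> Prop) :
  definable P -> definable (fun j v => ~ P j v).
Proof. by move=> dP; apply: definable_imp => //; apply: definable_const. Qed.

Lemma definable_and V (P Q : forall j, valuation V (N j) -> Prop) :
  definable P -> definable Q -> definable (fun j v => P j v /\ Q j v).
Proof.
move=> dP dQ; apply: (@definable_ext _ (fun j v => ~ (P j v -> ~ Q j v))).
  by move=> j v; split=> [/not_implyP[p /contrapT]|[p q] /(_ p)].
by apply: definable_not; apply: definable_imp => //; apply: definable_not.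
Qed.

Lemma definable_iff V (P Q : forall j, valuation V (N j) -> Prop) :
  definable P -> definable Q -> definable (fun j v => P j v <-> Q j v).
Proof. by move=> dP dQ; apply: definable_and; apply: definable_imp. Qed.

Lemma definable_ex V t (P : forall j, valuation V (N j) -> N j t -> Prop) :
  definable (fun j (w : valuation (extend V t) (N j)) =>
               P j (fun s x => w s (Old x)) (w t Fresh)) ->
  definable (fun j v => exists a, P j v a).
Proof.
move=> dP; apply: (@definable_ext _ (fun j v => ~ forall a, ~ P j v a)).
  by move=> j v; split=> [/existsNP[a /contrapT]|[a Pa] /(_ a)//]; exists a.
apply: definable_not.
by apply: (@definable_all _ _ (fun j v a => ~ P j v a)); apply: definable_not.
Qed.

Lemma definable_all_seq (X : eqType) (l : seq X) V
    (P : X -> forall j, valuation V (N j) -> Prop) :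
  (forall x, definable (P x)) ->
  definable (fun j v => forall x, x \in l -> P x j v).
Proof.
move=> dP; elim: l => [|a l IH].
  by apply: definable_ext (definable_const V True) => j v; split.
apply: definable_ext (definable_and (dP a) IH) => j v.
split=> [[Pa Pl] x|H]; last first.
  by split=> [|x xl]; apply: H; rewrite inE ?eqxx ?xl ?orbT.
by rewrite inE => /orP[/eqP->|/Pl].
Qed.

Lemma definable_all_fin (X : finType) V
    (P : X -> forall j, valuation V (N j) -> Prop) :
  (forall x, definable (P x)) -> definable (fun j v => forall x, P x j v).
Proof.
move=> /(definable_all_seq (enum X)); apply: definable_ext => j v.
by split=> H x => [|_]; apply: H; rewrite mem_enum.
Qed.

Lemma definable_ex_fin (X : finType) V
    (P : X -> forall j, valuation V (N j) -> Prop) :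
  (forall x, definable (P x)) -> definable (fun j v => exists x, P x j v).
Proof.
move=> dP; apply: (@definable_ext _ (fun j v => ~ forall x, ~ P x j v)).
  by move=> j v; split=> [/existsNP[a /contrapT]|[a Pa] /(_ a)//]; exists a.
by apply: definable_not; apply: definable_all_fin => x; apply: definable_not.
Qed.

(** A whole tuple of fresh variables at once, so that quantifiers over tuples of
arbitrary length need no bookkeeping of nested extensions. *)
Inductive extendn V (t : sorts L) (n : nat) : sorts L -> Type :=
| Freshn of 'I_n : extendn V t n t
| Oldn s of V s : extendn V t n s.

Lemma definable_alln V t n
    (P : forall j, valuation V (N j) -> ('I_n -> N j t) -> Prop) :
  definable (fun j (w : valuation (extendn V t n) (N j)) =>
    P j (fun s x => w s (Oldn _ _ x)) (fun i => w t (Freshn _ _ i))) ->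
  definable (fun j v => forall a, P j v a).
Proof.
elim: n V P => [|n IH] V P dP.
  pose f s (x : extendn V t 0 s) : V s :=
    match x in extendn _ _ _ s return V s with
    | Freshn i => match notF (ltn_ord i) with end
    | Oldn _ y => y
    end.
  apply: definable_ext (definable_rename f dP) => j v /=.
  split=> [H a|]; last exact.
  have -> // : a = (fun i : 'I_0 => v t (f t (Freshn V t i))).
  by apply/funext => -[].
pose f s (x : extendn V t n.+1 s) : extendn (extend V t) t n s :=
  match x in extendn _ _ _ s return extendn (extend V t) t n s with
  | Freshn i => if unlift ord0 i is Some i' then Freshn _ _ i'
                else Oldn _ _ Fresh
  | Oldn _ y => Oldn _ _ (Old y)
  end.
pose cons j (a : N j t) (b : 'I_n -> N j t) (i : 'I_n.+1) :=
  if unlift ord0 i is Some i' then b i' else a.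
have consE j a : a = @cons j (a ord0) (fun i => a (lift ord0 i)).
  by apply/funext => i; rewrite /cons; case: unliftP => [i'|] ->.
apply: (@definable_ext _ (fun j v => forall a b, P j v (cons j a b))).
  by move=> j v; split=> H a // ; rewrite (consE j a).
apply: (@definable_all _ _ (fun j v a => forall b, P j v (cons j a b))).
apply: (IH _ (fun j v b =>
  P j (fun s x => v s (Old x)) (cons j (v t Fresh) b))).
apply: definable_ext (definable_rename f dP) => j v /=.
have -> // : (fun i => v t (f t (Freshn V t i))) =
  cons j (v t (Oldn t n Fresh)) (fun i => v t (Freshn _ t i)).
by apply/funext => i; rewrite /cons /=; case: unlift.
Qed.

Lemma definable_exn V t n
    (P : forall j, valuation V (N j) -> ('I_n -> N j t) -> Prop) :
  definable (fun j (w : valuation (extendn V t n) (N j)) =>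
    P j (fun s x => w s (Oldn _ _ x)) (fun i => w t (Freshn _ _ i))) ->
  definable (fun j v => exists a, P j v a).
Proof.
move=> dP; apply: (@definable_ext _ (fun j v => ~ forall a, ~ P j v a)).
  by move=> j v; split=> [/existsNP[a /contrapT]|[a Pa] /(_ a)//]; exists a.
apply: definable_not.
apply: (@definable_alln _ _ _ (fun j v a => ~ P j v a)).
exact: definable_not.
Qed.

End Definable.

Lemma transfer (L : signature) (P : structure L -> Prop) (U M : structure L) :
  definable (N := id) (fun N (_ : valuation (no_var (L := L)) N) => P N) ->
  models (Th U) M -> P U -> P M.
Proof. by move=> [f hf] hM /(hf U (no_val U)) /hM /(hf M (no_val M)). Qed.

(** * The distance predicates and quantifier elimination *)

Definition le_dist d (R : distanceMonoid d) (M : structure (L_dist R)) (r : R)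
    (a b : M tt) : Prop :=
  interp M (r : symb (L_dist R)) (fun i : 'I_2 => if i == ord0 then a else b).

Definition home_val (L : language) (M : structure L) (X : Type)
    (v : X -> M tt) : valuation (L := L) (fun=> X) M :=
  fun s => match s with tt => v end.

Section Home.
Context {d : Order.disp_t} {R : distanceMonoid d}.
Local Notation L := (L_dist R).

Lemma le_distE (M : structure L) (r : R) (x : 'I_2 -> M tt) :
  interp M (r : symb L) x = le_dist r (x ord0) (x ord_max).
Proof.
rewrite /le_dist; congr (interp M _ _).
apply: functional_extensionality_dep => i.
case: i => -[|[|//]] hi; rewrite /eq_op /=; congr x; exact: val_inj.
Qed.

Lemma le_dist_space (A : metricSpace R) r (a b : A) :
  le_dist (M := metric_structure A) r a b <-> (dist a b <= r).
Proof. by []. Qed.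

Lemma definable_le J (N : J -> structure L) V (x y : V tt) (r : R) :
  definable (fun j (v : valuation (L := L) V (N j)) =>
    le_dist r (v tt x) (v tt y)).
Proof.
have := definable_atom N (P := r : symb L) (V := V)
  (fun i => if i == ord0 then x else y).
by apply: definable_ext => j v; rewrite le_distE.
Qed.

(** A quantifier-free formula mentions finitely many bounds. *)
Lemma qf_finite V (g : formula (L := L) V) : quantifier_free g ->
  exists D : seq R, forall (M : structure L) (v w : valuation V M),
    (forall x y r, r \in D ->
       le_dist r (v tt x) (v tt y) <-> le_dist r (w tt x) (w tt y)) ->
    (forall s x y, v s x = v s y <-> w s x = w s y) -> sat v g <-> sat w g.
Proof.
elim: g => [V'|V' s x y|V' P x|V' g IHg h IHh|V' t g IH] //=.
- by exists [::].
- by exists [::] => M v w _ ->.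
- move=> _; exists [:: P] => M v w h _; rewrite !le_distE.
  exact: (h (x ord0) (x ord_max) P (mem_head _ _)).
- move=> [/IHg[D hD] /IHh[D' hD']]; exists (D ++ D') => M v w hle heq.
  by rewrite (hD M v w) ?(hD' M v w) // => x y r rD; apply: hle;
    rewrite mem_cat rD ?orbT.
Qed.

Definition separated (M : structure L) :=
  forall x y : M tt, le_dist 0%D x y <-> x = y.

(** The bound 0 is added to [D] because it expresses equality. *)
Lemma qe_finite (T : set (sentence L)) (X : finType)
    (f : formula (L := L) (fun=> X)) : quantifier_elimination T ->
  exists D : seq R, 0%D \in D /\ forall (M : structure L), models T M ->
    separated M -> forall v w : X -> M tt,
    (forall x y r, r \in D ->
      le_dist r (v x) (v y) <-> le_dist r (w x) (w y)) ->
    sat (home_val v) f <-> sat (home_val w) f.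
Proof.
move=> qe.
have [g gqf hg] := qe #|X| (rename (fun _ => enum_rank) f).
have [D hD] := qf_finite gqf.
exists (0%D :: D); split=> [|M MT sepM v w h]; first exact: mem_head.
pose ev (u : X -> M tt) :=
  home_val (L := L) (fun i : 'I_#|X| => u (enum_val i)).
have evE u : sat (home_val u) f <-> sat (ev u) g.
  by rewrite -hg // sat_rename; apply: sat_ext => -[] x /=; rewrite enum_rankK.
rewrite !evE; apply: hD => [x y r rD|[] x y /=].
  by apply: h; rewrite inE rD orbT.
by rewrite -!sepM; apply: h; exact: mem_head.
Qed.

Lemma definable_supports (L' : signature) J (N : J -> structure L')
    (t : sorts L') (le : forall j, R -> N j t -> N j t -> Prop) :
  (forall V (x y : V t) r, definable (fun j (v : valuation V (N j)) =>
     le j r (v t x) (v t y))) ->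
  forall (D : seq R) n V (P : forall j, valuation V (N j) -> N j t -> Prop)
    (S : forall j, valuation V (N j) -> ('I_n -> N j t) -> Prop),
  definable (fun j (w : valuation (extend V t) (N j)) =>
     P j (fun s x => w s (Old x)) (w t Fresh)) ->
  definable (fun j (w : valuation (extendn V t n) (N j)) =>
     S j (fun s x => w s (Oldn _ _ x)) (fun i => w t (Freshn _ _ i))) ->
  definable (fun j v => supports (le j) D (P j v) (S j v)).
Proof.
move=> dle D n V P S dP dS.
apply: (@definable_alln _ _ _ _ _ _ (fun j v x => forall y,
  same_type (le j) D (P j v) x y -> (S j v x <-> S j v y))).
apply: (@definable_alln _ _ _ _ _ _ (fun j v y =>
  same_type (le j) D (P j (fun s x => v s (Oldn _ _ x)))
    (fun i => v t (Freshn _ _ i)) y ->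
  (S j (fun s x => v s (Oldn _ _ x)) (fun i => v t (Freshn _ _ i))
   <-> S j (fun s x => v s (Oldn _ _ x)) y))).
apply: definable_imp; last first.
  pose f1 s (x : extendn V t n s) : extendn (extendn V t n) t n s :=
    Oldn _ _ x.
  pose f2 s (x : extendn V t n s) : extendn (extendn V t n) t n s :=
    match x in extendn _ _ _ s return extendn (extendn V t n) t n s with
    | Freshn i => Freshn _ _ i | Oldn _ y => Oldn _ _ (Oldn _ _ y) end.
  apply: definable_iff; first exact: (definable_rename f1 dS).
  exact: (definable_rename f2 dS).
apply: definable_and.
  apply: definable_all_fin => i; apply: definable_all_fin => i'.
  by apply: definable_all_seq => r; apply: definable_iff; apply: dle.
apply: (@definable_all _ _ _ _ _ (fun j v u =>
  P j (fun s x => v s (Oldn _ _ (Oldn _ _ x))) u -> forall i r, r \in D ->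
  (le j r (v t (Oldn _ _ (Freshn _ _ i))) u <->
   le j r (v t (Freshn _ _ i)) u))).
apply: definable_imp.
  pose f3 s (x : V s) : extendn (extendn V t n) t n s := Oldn _ _ (Oldn _ _ x).
  exact: (definable_rename (lift_var f3 (t := t)) dP).
apply: definable_all_fin => i.
by apply: definable_all_seq => r; apply: definable_iff; apply: dle.
Qed.
End Home.

(** * Absorption in addition *)
Section Absorb.
Context {d : Order.disp_t} {R : distanceMonoid d} {U : metricSpace R}.
Hypothesis hU : urysohn_space U.
Hypothesis qe : quantifier_elimination (Th (metric_structure U)).
Local Notation L := (L_dist R).

(** The third distance is the largest that the triangle inequality allows, so that
[z] is in the ball of radius [r] around [y] only if [r + s = r]. *)
Lemma triangle_points (r s : R) : exists x y z : U,
  [/\ dist x y = s, dist x z = r & dist y z = (r + s)%D].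
Proof.
pose rho (a b : option bool) : R := match a, b with
  | None, None => 0%D
  | Some a, Some b => if a == b then 0%D else s
  | Some false, None | None, Some false => r
  | Some true, None | None, Some true => (r + s)%D
  end.
have [|||h hh] := urysohn_realize hU (rho := rho).
- by case=> [[]|].
- by case=> [[]|] [[]|].
- have e1 : r <= (s + (r + s))%D.
    by rewrite (le_trans (le_dplusl r s)) ?le_dplusr.
  have e2 : s <= (r + (r + s))%D.
    by rewrite (le_trans (le_dplusr r s)) ?le_dplusr.
  have e3 : r <= (r + s + s)%D by rewrite -dplusA le_dplusl.
  have e4 : s <= (r + s + r)%D by rewrite dplusC.
  have e5 : (r + s)%D <= (s + r)%D by rewrite dplusC.
  by case=> [[]|] [[]|] [[]|];
    rewrite /= ?dplus0 ?dplus0r ?dzero_le ?lexx ?le_dplusl ?le_dplusr.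
by exists (h (Some false)), (h (Some true)), (h None); rewrite !hh.
Qed.

Lemma separated_U : separated (metric_structure U).
Proof.
move=> x y; rewrite le_dist_space le_dzero; split=> [/eqP/dist_eq0//|->].
by rewrite dist_xx.
Qed.

(** [r + s = r] holds exactly when two points at distance [s] have the same ball
of radius [r]; by quantifier elimination this depends on finitely many
comparisons of [s]. *)
Lemma absorbing_cut (r : R) : exists D : seq R, forall s s' : R,
  (forall t, t \in D -> (s <= t) = (s' <= t)) ->
  (r + s)%D = r -> (r + s')%D = r.
Proof.
have [f hf] : definable (N := id) (fun (M : structure L)
    (v : valuation (L := L) (fun=> 'I_2) M) =>
    forall z : M tt, le_dist r (v tt ord0) z <-> le_dist r (v tt ord_max) z).
  apply: (@definable_all _ _ _ _ _ (fun (M : structure L)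
    (v : valuation (L := L) (fun=> 'I_2) M) z =>
     le_dist r (v tt ord0) z <-> le_dist r (v tt ord_max) z)).
  by apply: definable_iff; apply: definable_le.
have [D [D0 hD]] := qe_finite f qe.
exists D => s s' ss' rs.
have [x [y [z [xy xz yz]]]] := triangle_points r s.
have [x' [y' [z' [xy' xz' yz']]]] := triangle_points r s'.
pose v a b (i : 'I_2) : metric_structure U tt := if i == ord0 then a else b.
have := hD (metric_structure U) (fun _ h => h) separated_U (v x y) (v x' y').
rewrite !hf /= => -[|+ _].
  move=> i j t tD.
  rewrite /v; do 2!case: ifP => _; rewrite ?dist_xx //;
    rewrite 1?[dist y x]dist_sym 1?[dist y' x']dist_sym xy xy' ss' //.
move=> H; apply/eqP; rewrite eq_le le_dplusl andbT -yz'.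
apply H => [u|]; last by rewrite /v /= xz'.
have step a b : dist a b = s -> dist a u <= r -> dist b u <= r.
  move=> ab au; apply: (le_trans (dist_triangle b a u)).
  by rewrite dist_sym ab dplusC -[X in _ <= X]rs dplus_le.
by rewrite /v /=; split; apply: step => //; rewrite dist_sym.
Qed.

Hypothesis noidem :
  ~ (exists r : R, [/\ (r + r)%D = r, r <> 0%D & ~ (forall s : R, s <= r)]).

Lemma absorb_max (r s : R) : (r + s)%D = r -> s <> 0%D -> forall t : R, t <= r.
Proof.
move=> rs s0; have [D hD] := absorbing_cut r.
have down a b : (r + a)%D = r -> b <= a -> (r + b)%D = r.
  move=> ra ba; apply/eqP; rewrite eq_le le_dplusl andbT -[X in _ <= X]ra.
  exact: dplus_le.
apply: contrapT => /existsNP[t0 /negP ht0].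
have [t rt] : exists t, (r + t)%D <> r.
  by exists t0 => e; move: ht0; rewrite -e le_dplusr.
(* an absorbed element above [t2] would compare with the elements of [D] in the
   same way as [t1], which is not absorbed *)
have [t1 [/eqP rt1 t1D]] :=
  @seq_min _ _ (fun q => (r + q)%D != r) D t (introN eqP rt).
have [t2 [/eqP rt2 t2D]] :=
  @seq_max _ _ (fun q => (r + q)%D == r) D s (introT eqP rs).
have t2max a : (r + a)%D = r -> a <= t2.
  move=> ra; rewrite leNgt; apply/negP => t2a.
  apply: (rt1); apply: hD (ra) => q qD.
  have [rq|rq] := eqVneq (r + q)%D r.
    rewrite [a <= q]leNgt (le_lt_trans (t2D _ qD (introT eqP rq)) t2a) /=.
    by symmetry; apply/negP => tq; apply: rt1; apply: down tq.
  rewrite (t1D _ qD rq) ltW // ltNge; apply/negP => qa.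
  by move/eqP: rq; apply; apply: down qa.
apply: noidem; exists t2; split.
- apply/eqP; rewrite eq_le le_dplusl andbT; apply: t2max.
  by rewrite dplusA !rt2.
- move=> t20; apply: s0; apply/eqP; rewrite -le_dzero -t20; exact: t2max.
- move=> /(_ t) tt2; apply: rt; exact: down tt2.
Qed.

End Absorb.

(** * From the Urysohn space to the monster model *)
Section Transfer.
Context {d : Order.disp_t} {R : distanceMonoid d} {U : metricSpace R}.
Variable M : structure (L_dist R).
Hypothesis hU : urysohn_space U.
Hypothesis hM : models (Th (metric_structure U)) M.
Local Notation L := (L_dist R).

Lemma transfer_all2 (P : forall N : structure L, N tt -> N tt -> Prop) :
  definable (N := id) (V := extend (extend (no_var (L := L)) tt) tt)
    (fun N w => P N (w tt (Old Fresh)) (w tt Fresh)) ->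
  (forall x y, P (metric_structure U) x y) -> forall x y, P M x y.
Proof.
move=> dP; apply: (transfer (P := fun N => forall x y, P N x y)) => //.
apply: (@definable_all L _ id _ tt (fun N _ x => forall y, P N x y)).
exact: (@definable_all L _ id _ tt (fun N v y => P N (v tt Fresh) y)).
Qed.

Lemma separated_M : separated M.
Proof.
apply: (transfer_all2 (P := fun N x y => le_dist 0%D x y <-> x = y)).
  by apply: definable_iff; [apply: definable_le|apply: definable_eq].
exact: separated_U.
Qed.

Lemma le_distC r (x y : M tt) : le_dist r x y <-> le_dist r y x.
Proof.
move: x y.
apply: (transfer_all2 (P := fun N x y => le_dist r x y <-> le_dist r y x)).
  by apply: definable_iff; apply: definable_le.
by move=> x y; rewrite !le_dist_space dist_sym.
Qed.

Hypothesis absorb : forall r s : R,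
  (r + s)%D = r -> s <> 0%D -> forall t : R, t <= r.

Lemma definable_pair (V : sorts L -> Type) n (a x : 'I_n -> V tt)
    (g : formula (L := L) (fun=> ('I_n + 'I_n)%type)) :
  definable (N := id) (fun N (v : valuation (L := L) V N) =>
    sat (pair_val (fun i => v tt (a i)) (fun i => v tt (x i))) g).
Proof.
pose f s : ('I_n + 'I_n)%type -> V s :=
  match s with tt => fun z => match z with inl i => a i | inr i => x i end end.
have := definable_sat (id : structure L -> _) f g.
apply: definable_ext => N v.
by apply: sat_ext => -[] [].
Qed.

Lemma definable_supports_class (V : sorts L -> Type) n (a : 'I_n -> V tt)
    (g : formula (L := L) (fun=> ('I_n + 'I_n)%type)) (D : seq R)
    (P : forall N : structure L, valuation (L := L) V N -> N tt -> Prop) :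
  definable (N := id) (fun N (w : valuation (L := L) (extend V tt) N) =>
     P N (fun s x => w s (Old x)) (w tt Fresh)) ->
  definable (N := id) (fun N (v : valuation (L := L) V N) =>
    supports (@le_dist _ _ N) D (P N v)
      (fun x => sat (pair_val (fun i => v tt (a i)) x) g)).
Proof.
move=> dP.
apply: (@definable_supports _ R L _ id tt (fun N => @le_dist _ _ N) _ D n V P
  (fun N v x => sat (pair_val (fun i => v tt (a i)) x) g)) => //.
  by move=> W x y r; apply: definable_le.
exact: (definable_pair (V := @extendn L V tt n)
  (fun i => @Oldn L V tt n tt (a i)) (@Freshn L V tt n) g).
Qed.

(** For fixed lengths the statement about the Urysohn space is a single sentence,
because [D] and the formula defining the class are fixed. *)
Lemma supports_inter_M (D : seq R) n p q (A : 'I_p -> M tt) (B : 'I_q -> M tt)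
    (g : formula (L := L) (fun=> ('I_n + 'I_n)%type)) (a : 'I_n -> M tt) :
  0%D \in D ->
  let S x := sat (pair_val a x) g in
  supports (@le_dist _ _ M) D (fun u => exists i, A i = u) S ->
  supports (@le_dist _ _ M) D (fun u => exists i, B i = u) S ->
  supports (@le_dist _ _ M) D
    (fun u => (exists i, A i = u) /\ (exists i, B i = u)) S.
Proof.
move=> D0 /=; move: a A B.
pose Q (N : structure L) a (A : 'I_p -> N tt) (B : 'I_q -> N tt) :=
  let SN x := sat (pair_val a x) g in
  supports (@le_dist _ _ N) D (fun u => exists i, A i = u) SN ->
  supports (@le_dist _ _ N) D (fun u => exists i, B i = u) SN ->
  supports (@le_dist _ _ N) D
    (fun u => (exists i, A i = u) /\ (exists i, B i = u)) SN.
rewrite -/(forall a A B, @Q M a A B).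
apply: (transfer (P := fun N => forall a A B, @Q N a A B)
  (U := metric_structure U)) => //.
  apply: (@definable_alln L _ id _ tt _ (fun N _ a => forall A B, @Q N a A B)).
  apply: (@definable_alln L _ id _ tt _ (fun N v A => forall B,
    @Q N (fun i => v tt (Freshn _ _ i)) A B)).
  apply: (@definable_alln L _ id _ tt _ (fun N v B =>
    @Q N (fun i => v tt (Oldn _ _ (Freshn _ _ i)))
      (fun i => v tt (Freshn _ _ i)) B)).
  rewrite /Q.
  pose V1 := @extendn L (no_var (L := L)) tt n.
  pose V2 := @extendn L V1 tt p.
  pose V := @extendn L V2 tt q.
  pose Va i : V tt :=
    @Oldn L V2 tt q tt (@Oldn L V1 tt p tt (@Freshn L _ tt n i)).
  pose VA i : V tt := @Oldn L V2 tt q tt (@Freshn L V1 tt p i).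
  pose VB i : V tt := @Freshn L V2 tt q i.
  have dmem m (C : 'I_m -> V tt) : definable (N := id)
      (fun N (w : valuation (L := L) (extend V tt) N) =>
        exists i, w tt (Old (C i)) = w tt Fresh).
    by apply: definable_ex_fin => i; apply: definable_eq.
  have dsupp := @definable_supports_class V _ Va g D.
  apply: definable_imp; last apply: definable_imp.
  - exact: (dsupp (fun N v u => exists i, v tt (VA i) = u) (dmem _ VA)).
  - exact: (dsupp (fun N v u => exists i, v tt (VB i) = u) (dmem _ VB)).
  - apply: (dsupp (fun N v u =>
      (exists i, v tt (VA i) = u) /\ (exists i, v tt (VB i) = u))).
    exact: definable_and (dmem _ VA) (dmem _ VB).
move=> a A B SN SA SB.
pose k (t : 'I_p + 'I_q) : U := match t with inl i => A i | inr i => B i end.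
apply: (supports_inter hU D0 absorb (I := 'I_n) (k := k)) SA SB => //.
- by move=> u [i Ai]; exists (inl i).
- by move=> u [i Bi]; exists (inr i).
Qed.
End Transfer.

(** * Weak elimination of imaginaries *)

Definition param (L : signature) (M : structure L) (A : params M) s (x : M s)
  (Ax : A s x) : param_var A s := exist _ x (mem_set Ax).

Section Classes.
Variables (L : language) (M : structure L) (E : eq_formula M).

Lemma eqf_class_eq (a b : 'I_(eqf_dim E) -> M tt) :
  eqf_class (E := E) a = eqf_class (E := E) b <->
  sat (pair_val a b) (eqf_form E).
Proof.
have [refl symm trans] := eqf_equiv E.
split=> [e|ab].
  have : eqf_class (E := E) b b by apply: refl.
  by rewrite -e.
apply/funext => x; apply/propext; split=> [ax|bx].
  exact: trans (symm _ _ ab) ax.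
exact: trans ab bx.
Qed.
End Classes.

Section Elimination.
Context {d : Order.disp_t} {R : distanceMonoid d} {U : metricSpace R}.
Variable M : structure (L_dist R).
Hypothesis hU : urysohn_space U.
Hypothesis hM : models (Th (metric_structure U)) M.
Hypothesis qe : quantifier_elimination (Th (metric_structure U)).
Hypothesis absorb : forall r s : R,
  (r + s)%D = r -> s <> 0%D -> forall t : R, t <= r.
Local Notation L := (L_dist R).
Local Notation Leq := (eq_signature M).

(** Some support exists: the entries of any representative. *)
Lemma range_class_supports (E : eq_formula M) : exists D : seq R,
  0%D \in D /\ forall a : 'I_(eqf_dim E) -> M tt,
  supports (@le_dist _ _ M) D (fun u => exists i, a i = u)
    (fun x => sat (pair_val a x) (eqf_form E)).
Proof.
have [D [D0 hD]] := qe_finite (eqf_form E) qe.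
exists D; split=> // a x y [sxy sa].
pose v (x : 'I_(eqf_dim E) -> M tt) z :=
  match z with inl i => a i | inr i => x i end.
have vE z :
    sat (pair_val a z) (eqf_form E) <-> sat (home_val (v z)) (eqf_form E).
  by apply: sat_ext => -[] [].
rewrite !vE; apply: hD => //; first exact: (separated_M hM).
have sa' i j r : r \in D -> le_dist r (x i) (a j) <-> le_dist r (y i) (a j).
  by move=> rD; apply: sa => //; exists j.
move=> [i|i] [j|j] r rD //=.
- rewrite (le_distC hM _ (a i)) (le_distC hM _ (a i)); exact: sa'.
- exact: sa'.
- exact: sxy.
Qed.

Section MinimalSupport.
Variables (E : eq_formula M) (D : seq R) (a : 'I_(eqf_dim E) -> M tt).
Hypothesis D0 : 0%D \in D.
Let S x := sat (pair_val a x) (eqf_form E).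

Definition tuple_supports m (A : 'I_m -> M tt) :=
  supports (@le_dist _ _ M) D (fun u => exists i, A i = u) S.

(** The intersection of two supports of least size is a support, hence not
smaller than either. *)
Lemma minimal_support_unique m (A B : 'I_m -> M tt) :
  (forall k, (exists C : 'I_k -> M tt, tuple_supports C) -> (m <= k)%N) ->
  tuple_supports A -> tuple_supports B -> forall i, exists j, A j = B i.
Proof.
move=> mmin SA SB.
pose Q := [set i | `[< exists j, A j = B i >]]%SET.
have : (m <= #|Q|)%N.
  apply: mmin; exists (fun i => B (enum_val i)) => x y [h1 h2].
  apply: (supports_inter_M hU hM absorb D0 SA SB); split=> // u [[j Aj] [i Bi]].
  apply: h2; have iQ : i \in Q.
    by rewrite inE; apply/asboolP; exists j; rewrite Aj.
  by exists (enum_rank_in iQ i); rewrite enum_rankK_in.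
move=> mQ i; suff : i \in Q by rewrite inE => /asboolP.
have /eqP -> : Q == [set: 'I_m]%SET.
  by rewrite eqEcard finset.subsetT cardsT card_ord.
by rewrite inE.
Qed.

End MinimalSupport.

Let leM : R -> Meq M None -> Meq M None -> Prop := @le_dist d R M.

Lemma definable_leM (V : sorts Leq -> Type) (x y : V None) r :
  definable (fun (_ : unit) (v : valuation (L := Leq) V (Meq M)) =>
    leM r (v None x) (v None y)).
Proof.
have := definable_atom (fun _ : unit => Meq M) (P := inl r : symb Leq) (V := V)
  (fun i : 'I_2 => if i == ord0 then x else y).
apply: definable_ext => _ v; rewrite /leM /=.
by rewrite (le_distE (M := M) r (fun i => v None (if i == ord0 then x else y))).
Qed.

Definition projects (E : eq_formula M) (z : Meq M (Some E))
  (x : 'I_(eqf_dim E) -> Meq M None) : Prop := sval z = eqf_class x.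

Lemma definable_projects (E : eq_formula M) (V : sorts Leq -> Type)
    (z : V (Some E)) (x : 'I_(eqf_dim E) -> V None) :
  definable (fun (_ : unit) (v : valuation (L := Leq) V (Meq M)) =>
    projects (v _ z) (fun i => v _ (x i))).
Proof.
exact: (definable_atom (fun _ : unit => Meq M) (P := inr E : symb Leq) (V := V)
  (fun o => match o return V (@argsort Leq (inr E) o) with
            | Some i => x i | None => z end)).
Qed.

Lemma real_weak_canonical (e : Meq M None) :
  weak_canonical_parameter e (fun _ : 'I_1 => (e : M tt)).
Proof.
split=> [_|].
  have ee : imaginary_set e e by [].
  exists (Equal Fresh (Old (param ee))).
  split=> //.
  apply: (sub_finite_set (B := [set e]%classic)); last exact: finite_set1.
  by move=> b.
have ee : tuple_set (fun _ : 'I_1 => e) e by exists ord0.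
exists (Equal Fresh (Old (@param _ (Meq M) (tuple_set _) None e ee))).
by apply/seteqP; split=> b.
Qed.

(** Let [A] be a support of least size.  Its points are the only ones that belong
to a support of that size, a condition on [e]; and [e] is the class of every
tuple of the same type over [A] as [a]. *)
Lemma class_weak_canonical (E : eq_formula M) (e : Meq M (Some E)) :
  exists m (c : 'I_m -> M tt), weak_canonical_parameter e c.
Proof.
have [a _ ea] : range (@eqf_class _ _ E) (sval e).
  exact: set_mem (valP e).
have eS x : projects e x <-> sat (pair_val a x) (eqf_form E).
  by rewrite /projects -ea; apply: eqf_class_eq.
have [D [D0 Da]] := range_class_supports E.
pose supp m := exists C : 'I_m -> M tt, tuple_supports D a C.
have suppE m : reflect (supp m) `[< supp m >] by apply: asboolP.
have ex : exists m, `[< supp m >].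
  by exists (eqf_dim E); apply/suppE; exists a; apply: Da.
have [m /suppE[A SA] mmin] := ex_minnP ex.
exists m, A; split=> [i|].
- pose V : sorts Leq -> Type := extend (param_var (imaginary_set e)) None.
  pose ve : V (Some E) :=
    Old (@param _ (Meq M) (imaginary_set e) (Some E) e erefl).
  have [f hf] : definable (N := fun _ : unit => Meq M) (V := V) (fun _ v =>
      exists B : 'I_m -> Meq M None, (exists j, B j = v _ Fresh) /\
        supports leM D (fun u => exists j, B j = u) (projects (v _ ve))).
    apply: (@definable_exn Leq _ (fun=> Meq M) V None m (fun _ v B =>
      (exists j, B j = v _ Fresh) /\
        supports leM D (fun u => exists j, B j = u) (projects (v _ ve)))).
    apply: definable_and.
      by apply: definable_ex_fin => j; apply: definable_eq.
    pose W := @extendn Leq V None m.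
    apply: (@definable_supports _ R Leq _ (fun=> Meq M) None (fun=> leM) _ D _ W
       (fun _ v u => exists j, v _ (@Freshn Leq V None m j) = u)
       (fun _ v x => projects (v _ (@Oldn Leq V None m _ ve)) x)).
    + by move=> V' x y r; apply: definable_leM.
    + by apply: definable_ex_fin => j; apply: definable_eq.
    + exact: definable_projects.
  exists f; have solE b : solutions f b <-> exists B : 'I_m -> M tt,
      (exists j, B j = b) /\ tuple_supports D a B.
    rewrite /solutions /= (hf tt).
    split=> -[B [Bb SB]]; exists B; split=> // x y xy.
      by rewrite -!eS; apply: SB.
    by rewrite !eS; apply: SB.
  split; first by apply/solE; exists A; split=> //; exists i.
  apply: (sub_finite_set (B := range A)); last exact: finite_image.
  move=> b /solE[B [[j <-] SB]].
  have [k <-] : exists k, A k = B j.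
    apply: (@minimal_support_unique E D a D0 m A B) => // k hk.
    by apply: mmin; apply/suppE.
  by [].
- pose V : sorts Leq -> Type := extend (param_var (tuple_set A)) (Some E).
  have Aj j : tuple_set A (A j : Meq M None) by exists j.
  pose vA j : V None := Old (@param _ (Meq M) (tuple_set A) None _ (Aj j)).
  pose same_as_a (x : 'I_(eqf_dim E) -> Meq M None)
      (c : 'I_m -> Meq M None) :=
    (forall i j r, r \in D -> (le_dist r (a i) (a j) <-> leM r (x i) (x j))) /\
    (forall j i r, r \in D -> (le_dist r (a i) (A j) <-> leM r (x i) (c j))).
  have [f hf] : definable (N := fun _ : unit => Meq M) (V := V) (fun _ v =>
      exists x, projects (v _ Fresh) x /\ same_as_a x (fun j => v _ (vA j))).
    apply: (@definable_exn Leq _ (fun=> Meq M) V None _ (fun _ v x =>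
      projects (v _ Fresh) x /\ same_as_a x (fun j => v _ (vA j)))).
    apply: definable_and; first exact: definable_projects.
    by apply: definable_and; apply: definable_all_fin => i;
      apply: definable_all_fin => j; apply: definable_all_seq => r;
      apply: definable_iff; [exact: definable_const|exact: definable_leM
        |exact: definable_const|exact: definable_leM].
  exists f; apply/seteqP; split=> [b|_ ->] /=; rewrite /solutions /= (hf tt).
    move=> [x [bx [xx xA]]]; apply: val_inj => /=.
    have ax : sat (pair_val a x) (eqf_form E).
      apply/(SA a); last by apply/eqf_class_eq.
      by split=> // u [j <-]; apply: xA.
    by rewrite -ea bx; symmetry; apply/eqf_class_eq.
  by exists a; split=> //; symmetry.
Qed.

Lemma weak_elimination : weak_elimination_of_imaginaries M.
Proof.
case=> [E|] e; first exact: class_weak_canonical.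
by exists 1, (fun=> e); exact: real_weak_canonical.
Qed.
End Elimination.

(** * Automorphisms *)

Section Symmetry.
Variables (L : signature) (N : structure L).

(** Surjectivity instead of an inverse: on the sorts of classes the inverse of the
induced map would have to be constructed separately. *)
Record symmetry (G : forall s, N s -> N s) : Prop := Symmetry {
  symmetry_inj : forall s, injective (G s);
  symmetry_surj : forall s y, exists x, G s x = y;
  symmetry_interp : forall P x, interp N P x <-> interp N P (fun i => G _ (x i))
}.

Lemma automorphism_symmetry G : automorphism G -> symmetry G.
Proof.
case=> bij h; split=> // s; first exact: bij_inj.
by move=> y; have [f _ fK] := bij s; exists (f y).
Qed.

Lemma sat_symmetry G V (v : valuation V N) f : symmetry G ->
  sat v f <-> sat (fun s x => G s (v s x)) f.
Proof.
move=> hG; elim: f v => [|V' s x y|V' P x|V' g IHg h IHh|V' t g IH] v //=.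
- by split=> [->//|/(symmetry_inj hG)].
- exact: (symmetry_interp hG).
- by rewrite IHg IHh.
- split=> H a.
    have [b <-] := symmetry_surj hG a.
    by move: (H b); rewrite IH; apply: iffLR; apply: sat_ext => s [].
  rewrite IH; move: (H (G _ a)); apply: iffLR; apply: sat_ext => s x.
  by case: x.
Qed.

Lemma solutions_symmetry G (A : params N) t
    (f : formula (extend (param_var A) t)) b :
  symmetry G -> (forall s x, A s x -> G s x = x) ->
  solutions f b -> solutions f (G _ b).
Proof.
move=> hG fixA; rewrite /solutions /= (sat_symmetry _ _ hG).
apply: iffLR; apply: sat_ext => s [//|s' x] /=.
by apply: fixA; apply: set_mem; exact: (valP x).
Qed.
End Symmetry.

Section LiftToImaginaries.
Variables (L : language) (M : structure L) (g : forall s, M s -> M s).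
Hypothesis hg : symmetry g.

Lemma symmetry_pair n (f : formula (L := L) (fun=> ('I_n + 'I_n)%type)) a b :
  sat (pair_val a b) f <->
  sat (pair_val (fun i => g (a i)) (fun i => g (b i))) f.
Proof. by rewrite (sat_symmetry _ _ hg); apply: sat_ext => -[] []. Qed.

Lemma image_class (E : eq_formula M) (a : 'I_(eqf_dim E) -> M tt) :
  ((fun b i => g (b i)) @` eqf_class (E := E) a)%classic =
  eqf_class (E := E) (fun i => g (a i)).
Proof.
apply/seteqP; split=> [_ [b ab <-]|b ab].
  by rewrite /eqf_class /= -symmetry_pair.
have /choice[h hh] := symmetry_surj hg (s := tt).
exists (fun i => h (b i)); last by apply/funext => i.
apply/symmetry_pair; rewrite /eqf_class /= in ab.
by have -> : (fun i => g (h (b i))) = b by apply/funext => i.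
Qed.

Lemma image_class_range (E : eq_formula M) (z : eq_dom (Some E)) :
  ((fun b i => g (b i)) @` (sval z) \in range (@eqf_class _ _ E))%classic.
Proof.
case: z => z /= /set_mem[a _ <-]; rewrite image_class; apply: mem_set.
by exists (fun i => g (a i)).
Qed.

Definition eq_lift (s : sorts (eq_signature M)) : Meq M s -> Meq M s :=
  match s with
  | None => g (s := tt)
  | Some E => fun z =>
      exist (fun X => X \in range (@eqf_class _ _ E)) _ (image_class_range z)
  end.

Lemma eq_lift_symmetry : symmetry eq_lift.
Proof.
split.
- move=> [E|] /=; last exact (@symmetry_inj _ _ _ hg tt).
  move=> [x hx] [y hy] /(congr1 sval) /= e; apply: val_inj => /=.
  move: (set_mem hx) (set_mem hy) e => [a _ <-] [b _ <-].
  rewrite !image_class => /eqf_class_eq.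
  by rewrite -symmetry_pair => /eqf_class_eq.
- move=> [E|] /=; last exact (@symmetry_surj _ _ _ hg tt).
  move=> [y hy]; have [b _ by_] := set_mem hy.
  have /choice[h hh] := symmetry_surj hg (s := tt).
  have ha : eqf_class (fun i => h (b i)) \in range (@eqf_class _ _ E).
    by apply: mem_set; exists (fun i => h (b i)).
  exists (exist (fun X => X \in range (@eqf_class _ _ E)) _ ha).
  apply: val_inj => /=; rewrite image_class -by_.
  by congr eqf_class; apply/funext => i.
- move=> [P|E] x /=; first exact: (symmetry_interp hg).
  case: (x None) => z hz /=; have [a _ <-] := set_mem hz.
  rewrite image_class; split=> /eqf_class_eq h.
    by apply/eqf_class_eq; rewrite -symmetry_pair.
  by apply/eqf_class_eq; move: h; rewrite -symmetry_pair.
Qed.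

(** The parameter set of an imaginary is given by an equation across sorts, which
is why the map is applied to pairs of a sort and an element. *)
Lemma eq_lift_fix (s : sorts (eq_signature M)) (e : Meq M s) :
  eq_lift e = e -> forall t x, imaginary_set e x -> eq_lift (s := t) x = x.
Proof.
move=> fe t x xe.
pose tot (p : {s & Meq M s}) := existT (Meq M) _ (eq_lift (projT2 p)).
have : tot (existT _ t x) = existT _ t x by rewrite xe /tot /= fe.
exact: (@existT_inj2 {classic (sorts (eq_signature M))} (Meq M) t).
Qed.
End LiftToImaginaries.

(** * Idempotents obstruct weak elimination *)

Lemma card_le_injective (A B : Type) (f : A -> B) : injective f ->
  ([set: A] #<= [set: B])%card.
Proof.
move=> fI; have e : ([set: A] #= range f)%card.
  by rewrite card_eq_sym; apply: inj_card_eq => x y _ _ /fI.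
by rewrite (card_le_eql e); apply: subset_card_le.
Qed.

Section Monster.
Context {d : Order.disp_t} {R : distanceMonoid d} {U : metricSpace R}.
Variable M : structure (L_dist R).
Hypothesis hU : urysohn_space U.
Hypothesis qe : quantifier_elimination (Th (metric_structure U)).
Local Notation L := (L_dist R).

(** Among [k + 1] points at mutual distance [s] and at distance [s] from [a], one
is not in a list of length [k]. *)
Lemma equidistant (k : nat) (a : U) (s : R) (F : 'I_k -> U) : s <> 0%D ->
  exists y, dist y a = s /\ forall j, F j <> y.
Proof.
move=> s0.
pose rho (z z' : 'I_k.+1 + unit) := if z == z' then 0%D else s.
have [||||y [yy ya]] := urysohn_extend hU (rho := rho) (k := fun=> a).
- by move=> x; rewrite /rho eqxx.
- by move=> x y; rewrite /rho eq_sym.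
- move=> x y z; rewrite /rho; case: (eqVneq x y) => [->|_].
    by rewrite dplus0.
  by case: (x == z); rewrite ?dzero_le // le_dplusl.
- by move=> [] []; rewrite dist_xx.
apply: contrapT => H.
have /choice[h hh] : forall i : 'I_k.+1, exists j, F j = y i.
  move=> i; apply: contrapT => Hi; apply: H; exists (y i); split.
    by rewrite (ya i tt).
  by move=> j Fj; apply: Hi; exists j.
have hI : injective h.
  move=> i j hij; apply/eqP; have : dist (y i) (y j) = 0%D.
    by rewrite -!hh hij dist_xx.
  by rewrite yy /rho; case: eqP => [[->]|]//.
by have := leq_card h hI; rewrite !card_ord ltnn.
Qed.

Hypothesis hM : models (Th (metric_structure U)) M.

Lemma realize_finite (D : seq R) k (a c : M tt) (F : 'I_k -> M tt) : a <> c ->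
  exists y, (forall t, t \in D -> (le_dist t y a <-> le_dist t c a)) /\
    forall j, F j <> y.
Proof.
move: F; move: a c.
pose far_copy (N : structure L) (a c : N tt) (F : 'I_k -> N tt) y :=
  (forall t, t \in D -> (le_dist t y a <-> le_dist t c a)) /\
  forall j, F j <> y.
apply: (transfer (P := fun N : structure L => forall a c F,
  a <> c -> exists y, @far_copy N a c F y)) hM _.
  apply: (@definable_all L _ id _ tt (fun N _ a => forall c F,
    a <> c -> exists y, @far_copy N a c F y)).
  apply: (@definable_all L _ id _ tt (fun N v c => forall F,
    v tt Fresh <> c -> exists y, @far_copy N (v tt Fresh) c F y)).
  apply: (@definable_alln L _ id _ tt _ (fun N v F =>
    v tt (Old Fresh) <> v tt Fresh ->
    exists y, @far_copy N (v tt (Old Fresh)) (v tt Fresh) F y)).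
  apply: definable_imp; first exact/definable_not/definable_eq.
  set V := extendn _ _ _.
  pose va : V tt := @Oldn L _ tt k tt (Old Fresh).
  pose vc : V tt := @Oldn L _ tt k tt Fresh.
  apply: (@definable_ex L _ id _ tt (fun N v y =>
    @far_copy N (v tt va) (v tt vc) (fun j => v tt (@Freshn L _ tt k j)) y)).
  apply: definable_and.
    by apply: definable_all_seq => t; apply: definable_iff; apply: definable_le.
  by apply: definable_all_fin => j; apply/definable_not/definable_eq.
move=> a c F ac.
have [|y [ya Fy]] := @equidistant k a (dist c a) F.
  by move/dist_eq0 => ca; apply: ac.
by exists y; split=> // t _; rewrite !le_dist_space ya.
Qed.

Lemma le_refl (r : R) (x : M tt) : le_dist r x x.
Proof.
move: x; apply: (transfer (P := fun N : structure L =>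
  forall x : N tt, le_dist r x x)) hM _.
  apply: (@definable_all L _ id _ tt (fun N _ x => le_dist r x x)).
  exact: definable_le.
by move=> x; rewrite le_dist_space dist_xx dzero_le.
Qed.

Lemma le_triangle (r : R) (x y z : M tt) : (r + r)%D = r ->
  le_dist r x y -> le_dist r y z -> le_dist r x z.
Proof.
move=> rr; move: x y z.
apply: (transfer (P := fun N : structure L => forall x y z : N tt,
  le_dist r x y -> le_dist r y z -> le_dist r x z)) hM _.
  apply: (@definable_all L _ id _ tt (fun N _ x => forall y z,
    le_dist r x y -> le_dist r y z -> le_dist r x z)).
  apply: (@definable_all L _ id _ tt (fun N v y => forall z,
    le_dist r (v tt Fresh) y -> le_dist r y z -> le_dist r (v tt Fresh) z)).
  apply: (@definable_all L _ id _ tt (fun N v z =>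
    le_dist r (v tt (Old Fresh)) (v tt Fresh) ->
    le_dist r (v tt Fresh) z -> le_dist r (v tt (Old Fresh)) z)).
  by apply: definable_imp; [|apply: definable_imp]; apply: definable_le.
move=> x y z; rewrite !le_dist_space => xy yz.
by apply: (le_trans (dist_triangle x y z)); rewrite -rr dplus_le.
Qed.

Lemma two_classes (r : R) : ~ (forall s : R, (s <= r)%O) ->
  exists a b : M tt, ~ le_dist r a b.
Proof.
move=> /existsNP[s /negP sr].
apply: (transfer (P := fun N : structure L =>
  exists a b : N tt, ~ le_dist r a b)) hM _.
  apply: (@definable_ex L _ id _ tt (fun N _ a => exists b, ~ le_dist r a b)).
  apply: (@definable_ex L _ id _ tt (fun N v b => ~ le_dist r (v tt Fresh) b)).
  exact/definable_not/definable_le.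
have [x [y [_ [xy _ _]]]] := triangle_points hU 0%D s.
by exists x, y; rewrite le_dist_space xy; apply/negP.
Qed.

Lemma second_point (r : R) (a : M tt) : r <> 0%D ->
  exists b, b <> a /\ le_dist r a b.
Proof.
move=> r0; move: a; apply: (transfer (P := fun N : structure L =>
  forall a : N tt, exists b, b <> a /\ le_dist r a b)) hM _.
  apply: (@definable_all L _ id _ tt (fun N _ a =>
    exists b, b <> a /\ le_dist r a b)).
  apply: (@definable_ex L _ id _ tt (fun N v b =>
    b <> v tt Fresh /\ le_dist r (v tt Fresh) b)).
  apply: definable_and; first exact/definable_not/definable_eq.
  exact: definable_le.
move=> a; have [y [ya Fy]] := @equidistant 1 a r (fun=> a) r0.
exists y; split; first by move=> e; apply: (Fy ord0).
by rewrite le_dist_space dist_sym ya.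
Qed.

Definition tuple_params n (v : 'I_n -> M tt) : params M :=
  fun s => match s with tt => range v end.

Arguments tuple_params {n} v s _.

Definition tuple_index n (v : 'I_n -> M tt) s :
    param_var (tuple_params v) s -> 'I_n :=
  match s with tt => fun x => sval (cid2 (set_mem (valP x))) end.

Lemma tuple_indexP n (v : 'I_n -> M tt) (x : param_var (tuple_params v) tt) :
  v (tuple_index x) = sval x.
Proof. by rewrite /tuple_index; case: cid2. Qed.

Variable K : Type.
Hypothesis hK : card_lt (sorts L + symb L + nat) K.

Lemma small_tuple n (v : 'I_n -> M tt) : small K (tuple_params v).
Proof.
pose f (x : {s & tuple_params v s}) : sorts L + symb L + nat :=
  inr (nat_of_ord (@tuple_index n v (projT1 x) (projT2 x))).
have fI : injective f.
  move=> [[] x] [[] y] [] /val_inj /= /(congr1 v) h; congr existT.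
  by apply: val_inj; move: h; rewrite !tuple_indexP.
have le_f := card_le_injective fI; case: hK => h1 h2; split.
  exact: card_le_trans le_f h1.
by move=> Kv; apply: h2; apply: card_le_trans Kv le_f.
Qed.

Hypothesis homog : strongly_homogeneous K M.

(** By quantifier elimination a map of a finite tuple that preserves the distance
relations is elementary. *)
Lemma extend_to_symmetry n (v w : 'I_n -> M tt) :
  (forall i j t, le_dist t (v i) (v j) <-> le_dist t (w i) (w j)) ->
  exists2 g : forall s, M s -> M s, symmetry g & forall i, g tt (v i) = w i.
Proof.
move=> vw.
pose h : valuation (L := L) (param_var (tuple_params v)) M :=
  fun s => match s with tt => fun x => w (@tuple_index n v tt x) end.
have hE : elementary_map h.
  move=> f; have [D [_ hD]] := qe_finite (rename (@tuple_index n v) f) qe.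
  have := hD M hM (separated_M hM) v w (fun i j t _ => vw i j t).
  rewrite !sat_rename => e; split=> H.
    apply/(sat_ext (w := fun s x => home_val w (tuple_index x))); first by case.
    apply/e; apply: iffLR H; apply: sat_ext => -[] x /=.
    by rewrite tuple_indexP.
  apply/(sat_ext (w := fun s x => home_val v (tuple_index x))).
    by move=> [] x /=; rewrite tuple_indexP.
  by apply/e; apply: iffLR H; apply: sat_ext => -[] x.
have [g /automorphism_symmetry gS gh] := homog (small_tuple v) hE.
exists g => // i.
have iv : range v (v i) by exists i.
pose vi := @param _ M (tuple_params v) tt _ iv.
have -> : g tt (v i) = w (@tuple_index n v tt vi) by exact: (gh tt vi).
have viE := tuple_indexP vi.
by apply/(separated_M hM); rewrite -vw viE; apply: le_refl.
Qed.

Hypothesis sat_M : saturated K M.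

(** The type says that [y] has the same relations to [a] as [c] and is different
from the elements of [F]. *)
Lemma realize_type (a c : M tt) (F : set (M tt)) : a <> c -> finite_set F ->
  exists y, (forall t, le_dist t y a <-> le_dist t c a) /\ ~ F y.
Proof.
move=> ac finF.
have [l lF] := (@finite_seqP {classic (M tt)} F).1 finF.
pose v (i : 'I_(size l).+1) : M tt :=
  if unlift ord0 i is Some j then tnth (in_tuple l) j else a.
pose A := tuple_params v.
pose V : sorts L -> Type := extend (param_var A) tt.
pose X i : V tt := Old (@param _ M A tt (v i) (ex_intro2 _ _ i I erefl)).
pose atom t : formula (L := L) V :=
  Atom (t : symb L) (fun i : 'I_2 => if i == ord0 then Fresh else X ord0).
pose lit t := if `[< le_dist t c a >] then atom t else Imp (atom t) Bot.
pose neq (j : 'I_(size l)) : formula (L := L) V :=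
  Imp (Equal (Fresh : V tt) (X (lift ord0 j))) Bot.
have v0 : v ord0 = a by rewrite /v unlift_none.
have litP t y : solutions (lit t) y <-> (le_dist t y a <-> le_dist t c a).
  have atomP : sat (extend_val (param_val A) y) (atom t) <-> le_dist t y a.
    by rewrite /= le_distE /= v0.
  have -> : solutions (lit t) y =
    sat (extend_val (param_val A) y) (lit t) by [].
  rewrite /lit; case: asboolP => ca; first by rewrite atomP; tauto.
  have -> : sat (extend_val (param_val A) y) (Imp (atom t) Bot) =
    ~ sat (extend_val (param_val A) y) (atom t) by [].
  rewrite atomP; tauto.
have neqP j y : solutions (neq j) y <-> y <> v (lift ord0 j) by [].
pose p := [set f : formula (L := L) V |
  (exists t, f = lit t) \/ exists j, f = neq j]%classic.
have [y hy] : exists y, forall f, p f -> solutions f y.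
  apply: (sat_M (small_tuple v)) => q qp finq.
  (* the bounds of the finitely many literals in [q] *)
  pose tau f := xget (0%D : R) [set t | f = lit t]%classic.
  have [D hD] := (@finite_seqP R (tau @` q)%classic).1 (finite_image _ finq).
  have [y [yD yF]] :=
    realize_finite D (fun j : 'I_(size l) => v (lift ord0 j)) ac.
  exists y => f qf; have [[t ft]|[j ->]] := qp f qf; last first.
    by apply/neqP => e; apply: (yF j).
  have -> : f = lit (tau f) by rewrite /tau; case: xgetP => // /(_ t).
  apply/litP; apply: yD.
  have : (tau @` q)%classic (tau f) by exists f.
  by rewrite hD.
exists y; split=> [t|]; first by apply/litP/hy; left; exists t.
rewrite lF /= => yl.
have [j yj] := seq_tnthP yl.
have : solutions (neq j) y by apply: hy; right; exists j.
move/neqP; apply; rewrite /v liftK.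
exact: yj.
Qed.

Section Idempotent.
Variable r : R.
Hypothesis rr : (r + r)%D = r.
Hypothesis r0 : r <> 0%D.
Hypothesis r_max : ~ (forall s : R, (s <= r)%O).

Definition ball_formula : formula (L := L) (fun=> ('I_1 + 'I_1)%type) :=
  Atom (r : symb L) (fun i : 'I_2 => if i == ord0 then inl ord0 else inr ord0).

Lemma sat_ball (a b : 'I_1 -> M tt) :
  sat (pair_val a b) ball_formula <-> le_dist r (a ord0) (b ord0).
Proof. by rewrite /= le_distE. Qed.

Lemma ball_equivalence : RelationClasses.Equivalence
  (fun a b : 'I_1 -> M tt => sat (pair_val a b) ball_formula).
Proof.
split=> [a|a b|a b c]; rewrite !sat_ball; first exact: le_refl.
  by rewrite (le_distC hM).
exact: le_triangle.
Qed.

Definition ball_eq : eq_formula M := EqFormula ball_equivalence.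

Lemma ball_class_mem (a : M tt) :
  eqf_class (E := ball_eq) (fun=> a) \in range (@eqf_class _ _ ball_eq).
Proof. by apply: mem_set; exists (fun=> a). Qed.

Definition ball (a : M tt) : Meq M (Some ball_eq) :=
  exist (fun X => X \in range (@eqf_class _ _ ball_eq)) _ (ball_class_mem a).

Lemma ball_eqP a b : ball a = ball b <-> le_dist r a b.
Proof.
rewrite -(sat_ball (fun=> a) (fun=> b)) -(eqf_class_eq (E := ball_eq)).
by split=> [/(congr1 sval)|h]; last exact: val_inj.
Qed.

Lemma eq_lift_ball g (hg : symmetry g) a : eq_lift hg (ball a) = ball (g tt a).
Proof. by exact/val_inj/(image_class hg (E := ball_eq) (fun=> a)). Qed.

(** A map of one point is elementary, so all balls are conjugate. *)
Lemma ball_not_over_empty a (c : 'I_0 -> M tt) :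
  ~ dcl (tuple_set c) (Some ball_eq) (ball a).
Proof.
move=> [f fa]; have [x [y xy]] := two_classes r_max.
have swap z : ball z = ball a.
  have [|g gS gz] := @extend_to_symmetry 1 (fun=> a) (fun=> z).
    by move=> i j t; split=> _; apply: le_refl.
  have : solutions f (ball a) by rewrite fa.
  move/(solutions_symmetry (eq_lift_symmetry gS)).
  rewrite eq_lift_ball (gz ord0) fa; apply => -[E|] u //= [[]] //.
by apply: xy; apply/ball_eqP; rewrite !swap.
Qed.

(** The center is changed if it is [c] itself, since the construction of other
points of the type of [c] over the center needs a positive distance. *)
Lemma ball_acl_real a c : ~ acl (imaginary_set (ball a)) None c.
Proof.
wlog ac : a / a <> c.
  move=> H; have [->|ac] := pselect (a = c); last exact: H.
  have [b [bc cb]] := second_point c r0.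
  by rewrite (_ : ball c = ball b); [apply: H|apply/ball_eqP].
move=> [f [fc finf]].
have [y [yc]] := realize_type ac finf; apply.
pose v (z : M tt) (i : 'I_2) := if i == ord0 then a else z.
have [|g gS gv] := @extend_to_symmetry 2 (v c) (v y).
  move=> i j t; rewrite /v; case: ifP => _; case: ifP => _ //.
  - by rewrite !(le_distC hM _ a) yc.
  - by rewrite yc.
  - by split=> _; apply: le_refl.
have ga := gv ord0; have gc := gv ord_max; rewrite /v /= in ga gc.
have -> : y = eq_lift gS (s := None) c by rewrite /= gc.
apply: (solutions_symmetry (eq_lift_symmetry gS) _ fc).
apply: eq_lift_fix; by rewrite eq_lift_ball ga.
Qed.

Lemma ball_no_weak_parameter : ~ weak_elimination_of_imaginaries M.
Proof.
move=> wei; have [a _] := two_classes r_max.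
have [[|m] [c [c_acl c_dcl]]] := wei _ (ball a).
  exact: ball_not_over_empty c_dcl.
exact: ball_acl_real (c_acl ord0).
Qed.

End Idempotent.
End Monster.

Theorem theorem4 (d : Order.disp_t) (R : distanceMonoid d)
    (U : metricSpace R) (M : structure (L_dist R))
    (hR : urysohn_monoid R) (hU : urysohn_space U)
    (hM : monster_model (Th (metric_structure U)) M) :
  weak_elimination_of_imaginaries M <->
  ~ (exists r : R, [/\ (r + r)%D = r, r <> 0%D & ~ (forall s : R, (s <= r)%O)]).
Proof.
have qe : quantifier_elimination (Th (metric_structure U)) := hR.2 _ hU.
have [MU [K [hK sat_M homog]]] := hM.
split=> [wei [r [rr r0 r_max]]|noidem].
  exact: (ball_no_weak_parameter hU qe MU hK homog sat_M rr r0 r_max wei).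
exact: (weak_elimination hU MU qe (absorb_max hU qe noidem)).
Qed.
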